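(* Let $N\geq 5$ and let $\kappa,\mu_L,\mu_R$ be real numbers (independent of $\beta$) with $\mu_L>\kappa>0>\mu_R$ and $|\mu_R|>\kappa$. Let $\rho=\rho_\beta$ be the unique stationary distribution of the boundary driven Kawasaki process on $\{0,1\}^N$ at inverse temperature $\beta$. Then for $x\in\{0,1\}^N$, $$\rho_\beta(x)\asymp 1 \quad\text{if and only if}\quad x=\eta_{p,q}\ \text{for some } p\geq 3,\ q\geq 2,\ p+q=N,$$ where $\eta_{p,q}=(1,\dots,1,0,\dots,0)$ consists of $p$ occupied sites followed by $q$ vacant sites. For all other $x\in\{0,1\}^N$, $\rho_\beta(x)\asymp e^{-\beta\alpha}$ for some $\alpha>0$ (depending on $x$).
   Context: Configurations are $x\in\{0,1\}^N$ on sites $1,\dots,N$; $x(i)=1$ means site $i$ is occupied. Energy: $E(x)=-\kappa\sum_{i=1}^{N-1}x(i)x(i+1)$. For $i\neq j$, $x^{i,j}$ is $x$ with the occupations of sites $i$ and $j$ exchanged; for $i\in\{1,N\}$, $x^i$ is $x$ with the occupation of site $i$ flipped. The boundary driven Kawasaki process is the continuous-time Markov jump process on $\{0,1\}^N$ whose only transitions are: for nearest neighbours $|i-j|=1$ with $x(i)\neq x(j)$, $x\to x^{i,j}$ at rate $\exp[-\tfrac{\beta}{2}(E(x^{i,j})-E(x))]$; and for $i\in\{1,N\}$, $x\to x^i$ at rate $\exp[\tfrac{\beta\mu_i}{2}(1-2x(i))]\exp[-\tfrac{\beta}{2}(E(x^i)-E(x))]$, where $\mu_1=\mu_L$ and $\mu_N=\mu_R$.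 This process is irreducible and has a unique stationary distribution $\rho_\beta$. Notation: $f(\beta)\asymp e^{\beta h}$ means $\lim_{\beta\to\infty}\frac1\beta\log f(\beta)=h$; in particular $f(\beta)\asymp 1$ means this limit is $0$. *)

(* Defs.v *)
From HB Require Import structures.
From mathcomp Require Import all_boot all_order all_algebra.
From mathcomp Require Import all_classical all_reals all_analysis.
Set Implicit Arguments. Unset Strict Implicit. Unset Printing Implicit Defensive.
Import Order.TTheory GRing.Theory Num.Theory.
Import numFieldNormedType.Exports.
Local Open Scope ring_scope.

(* Configurations on sites 1..N, represented by ordinals 0..N-1:
   site k (1-based) is the ordinal k-1. *)
Definition config (N : nat) := {ffun 'I_N -> bool}.

Definition occ_nat (N : nat) (x : config N) (k : nat) : bool :=
  match @insub nat (fun k => k < N)%N 'I_N k with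
  | Some i => x i
  | None => false
  end.

Section Kawasaki.
Variable R : realType.
Variable N : nat.

Definition occ (x : config N) (i : 'I_N) : R := (x i)%:R.

Definition energy (kappa : R) (x : config N) : R :=
  - kappa * \sum_(0 <= k < N.-1) ((occ_nat x k && occ_nat x k.+1) : nat)%:R.

Definition swap (x : config N) (i j : 'I_N) : config N :=
  [ffun k => if k == i then x j else if k == j then x i else x k].

Definition flip (x : config N) (i : 'I_N) : config N :=
  [ffun k => if k == i then ~~ x k else x k].

Definition rate (beta kappa muL muR : R) (x y : config N) : R :=
  \sum_(i : 'I_N) \sum_(j : 'I_N | [&& (i.+1 == j)%N, x i != x j & swap x i j == y])
      expR (- (beta / 2) * (energy kappa (swap x i j) - energy kappa x))
  + \sum_(i : 'I_N | ((i : nat) == 0)%N && (flip x i == y))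
      expR ((beta * muL / 2) * (1 - 2 * occ x i))
      * expR (- (beta / 2) * (energy kappa (flip x i) - energy kappa x))
  + \sum_(i : 'I_N | ((i : nat) == N.-1)%N && (flip x i == y))
      expR ((beta * muR / 2) * (1 - 2 * occ x i))
      * expR (- (beta / 2) * (energy kappa (flip x i) - energy kappa x)).

Definition stationary (beta kappa muL muR : R) (rho : config N -> R) : Prop :=
  (forall x, 0 <= rho x) /\ (\sum_x rho x = 1) /\
  (forall y, \sum_x rho x * rate beta kappa muL muR x y
             = rho y * \sum_z rate beta kappa muL muR y z).

Definition eta (p : nat) : config N := [ffun i : 'I_N => (i < p)%N].

Definition is_eta_good (x : config N) : Prop :=
  exists p q : nat, [/\ (3 <= p)%N, (2 <= q)%N, (p + q = N)%N & x = eta p].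

End Kawasaki.

Definition asymp {R : realType} (f : R -> R) (h : R) : Prop :=
  ((fun b : R => ln (f b) / b) @ +oo%classic --> h)%classic.

(* Main.v *)
(** Eliminating states one by one expresses the stationary weights through sums, products
    and quotients of exponentials, so each weight has an exponent h(x), and balance of flow
    across any cut reads: the largest value of h(x) plus the exponent of the rate is the same
    for the jumps leaving and entering a set. In units of kappa / 2, a jump followed from
    the fastest exits carries a flow that cannot decrease.  A configuration whose blocks and
    gaps all have length at least three is left, even after arbitrary returns, only at
    exponent -2 below its own level.  From a configuration of level 0 that is of
    another kind or has several blocks, flow of exponent at least -2 leads either to such a
    configuration with smaller potential or to the steps (1,..,1,0,..,0) together with the
    single particles and holes travelling between them.  The latter set is left only at
    exponents below -2, so everything outside it has negative level.  Finally, a travelling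
    hole (particle) carries a flow of exponent -2 from each step to the next (previous) one,
    which forces all steps with p >= 3 and q >= 2 to have the same level. *)

Require Import Defs.
From HB Require Import structures.
From mathcomp Require Import all_boot all_order all_algebra.
From mathcomp Require Import all_classical all_reals all_analysis.
From mathcomp Require Import zify ring lra.
Import Order.TTheory GRing.Theory Num.Theory.
Import numFieldNormedType.Exports.
Local Open Scope ring_scope.

Set Implicit Arguments. Unset Strict Implicit. Unset Printing Implicit Defensive.

(** The two reservoirs break detailed balance, so no formula for h is available and every estimate
    is a cut. A cut around one configuration is sharp only if its fastest exit is not an immediate
    return; otherwise the cut must surround a set that contains the returns. The number -2 arises as
    follows: detaching a particle costs one bond, exponent -1, and is undone at exponent 1, so the
    detached state lies 2 below its origin; afterwards the particle or the hole moves at exponent 0.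
    The two bounds on the good steps come from leaks at exponent -1. A block of two breaks up, site
    1 is refilled, and the step p = 3 results; a particle at N-1 with N vacant hops to N and is
    removed. The neighbouring step answers only at exponents below -1, so p = 2 and q = 1 have
    negative level. Of the reservoirs it is only known that a, b > 1. Next to an occupied site N-1
    the right one acts at exponents 1 - b and b - 1, which may be arbitrarily close to 0. Hence the
    special treatment of configurations with site N-1 occupied. *)

Section Configurations.
Variable N : nat.
Implicit Types (x y : config N) (k : nat).

(* Sites are numbered from 1 as in the informal text; site 0 and all sites beyond
   N read as vacant. *)
Definition site x k : bool := (0 < k)%N && occ_nat x k.-1.

Definition of_site (f : nat -> bool) : config N := [ffun i : 'I_N => f i.+1].

Lemma siteS x (i : 'I_N) : site x i.+1 = x i.
Proof. by rewrite /site /occ_nat /= valK. Qed.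

Lemma site0 x : site x 0 = false.
Proof. by []. Qed.

Lemma site_out x k : (N < k)%N -> site x k = false.
Proof.
case: k => // k lt_Nk; rewrite /site /occ_nat /=.
by rewrite insubF // ltnNge -ltnS lt_Nk.
Qed.

Lemma site_bound x k : site x k -> (0 < k <= N)%N.
Proof.
case: (ltnP 0 k) => [k_gt0|]; last by rewrite leqn0 => /eqP ->.
by case: (leqP k N) => // /site_out ->.
Qed.

Lemma site_of_site f k : site (of_site f) k = (0 < k <= N)%N && f k.
Proof.
case: (boolP (0 < k <= N)%N) => [/andP[]|]; last first.
  by apply: contraNF => /site_bound.
by case: k => // k _ lt_kN; rewrite (siteS _ (Ordinal lt_kN)) ffunE.
Qed.

Lemma site_inj x y : (forall k, (0 < k <= N)%N -> site x k = site y k) -> x = y.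
Proof. by move=> eq_xy; apply/ffunP => i; rewrite -!siteS; apply: eq_xy; rewrite ltnS leq0n ltn_ord. Qed.

(** * Exchanges and flips, and their effect on bonds and weighted occupation *)

Definition hop x k : config N :=
  of_site (fun j => if j == k then site x k.+1 else
                    if j == k.+1 then site x k else site x j).

Definition toggle x k : config N :=
  of_site (fun j => if j == k then ~~ site x k else site x j).

Lemma site_hop x k j : (0 < k < N)%N ->
  site (hop x k) j =
  if j == k then site x k.+1 else if j == k.+1 then site x k else site x j.
Proof.
move=> kN; rewrite site_of_site; case: (boolP (0 < j <= N)%N) => //= jN.
rewrite !ifF; [|lia|lia]; by apply/esym; apply: contraNF jN => /site_bound.
Qed.

Lemma site_toggle x k j : (0 < k <= N)%N ->
  site (toggle x k) j = if j == k then ~~ site x k else site x j.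
Proof.
move=> kN; rewrite site_of_site; case: (boolP (0 < j <= N)%N) => //= jN.
rewrite ifF; last by lia.
by apply/esym; apply: contraNF jN => /site_bound.
Qed.

Lemma site_eta p k : site (Defs.eta N p) k = (0 < k <= N)%N && (k <= p)%N.
Proof. exact: (site_of_site (fun k => k <= p)%N). Qed.

Lemma hopE x k : (0 < k < N)%N -> site x k != site x k.+1 ->
  hop x k = toggle (toggle x k) k.+1.
Proof.
move=> kN neq; apply: site_inj => j _.
have tE i : site (toggle x k) i = if i == k then ~~ site x k else site x i.
  by rewrite site_toggle //; lia.
rewrite site_hop // site_toggle ?tE; last by lia.
rewrite (_ : (k.+1 == k) = false); last lia.
case: (j =P k) => [->|_]; last by case: (site x k) neq; case: (site x k.+1).
rewrite (_ : (k == k.+1) = false); last lia.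
by case: (site x k) neq; case: (site x k.+1).
Qed.

Lemma hopK x k : (0 < k < N)%N -> hop (hop x k) k = x.
Proof.
move=> kN; apply: site_inj => j _; rewrite !site_hop // eqxx.
rewrite (_ : (k.+1 == k) = false); last lia.
by case: (j =P k) => [->//|_]; rewrite eqxx; case: (j =P k.+1) => [->|].
Qed.

Lemma toggleK x k : (0 < k <= N)%N -> toggle (toggle x k) k = x.
Proof.
move=> kN; apply: site_inj => j _; rewrite !site_toggle // eqxx.
by case: (j =P k) => [->|//]; rewrite negbK.
Qed.

Lemma sum_change1 (n k : nat) (F G : nat -> int) : (k < n)%N ->
  (forall j, j != k -> F j = G j) ->
  \sum_(0 <= j < n) F j = \sum_(0 <= j < n) G j + (F k - G k).
Proof.
move=> kn FG; rewrite !big_mkord (bigD1 (Ordinal kn)) //=.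
rewrite [in RHS](bigD1 (Ordinal kn)) //= (eq_bigr (fun j : 'I_n => G j)).
  by lia.
by move=> j jk; apply: FG.
Qed.

Lemma sum_change2 (n k : nat) (F G : nat -> int) : (k.+1 < n)%N ->
  (forall j, j != k -> j != k.+1 -> F j = G j) ->
  \sum_(0 <= j < n) F j =
  \sum_(0 <= j < n) G j + (F k - G k) + (F k.+1 - G k.+1).
Proof.
move=> kn FG; pose H j := if j == k then F j else G j.
rewrite (@sum_change1 n k.+1 F H) //; last first.
  by move=> j jk; rewrite /H; case: eqP => // /eqP jk'; rewrite FG.
rewrite (@sum_change1 n k H G); [|lia|]; last first.
  by move=> j jk; rewrite /H (negbTE jk).
by rewrite /H eqxx (_ : (k.+1 == k) = false) //; lia.
Qed.

(** The vacant sites 0 and [N.+1] are included, so that flips at the two ends need no boundary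
    case. *)
Definition bonds x : int := \sum_(0 <= k < N.+1) (site x k && site x k.+1)%:Z.

Lemma bonds_toggle x k : (0 < k <= N)%N ->
  bonds (toggle x k) =
  bonds x + (1 - 2 * (site x k)%:Z) * ((site x k.-1)%:Z + (site x k.+1)%:Z).
Proof.
case: k => // m; rewrite /= => mN; rewrite /bonds.
have tE j := @site_toggle x m.+1 j mN.
rewrite (@sum_change2 _ m _ (fun k => (site x k && site x k.+1)%:Z)); [|lia|].
  rewrite !tE !eqxx (_ : (m == m.+1) = false); last lia.
  rewrite (_ : (m.+2 == m.+1) = false); last lia.
  case: (site x m); case: (site x m.+1); case: (site x m.+2) => /=; lia.
move=> j /negbTE jm /negbTE jm1; rewrite !tE jm1.
by rewrite eqSS jm.
Qed.

Definition weight (w : nat -> int) x : int :=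
  \sum_(0 <= k < N.+1) w k * (site x k)%:Z.

Lemma weight_toggle w x k : (0 < k <= N)%N ->
  weight w (toggle x k) = weight w x + (1 - 2 * (site x k)%:Z) * w k.
Proof.
move=> kN; rewrite /weight.
have tE j := @site_toggle x k j kN.
rewrite (@sum_change1 _ k _ (fun k => w k * (site x k)%:Z)); [|lia|].
  rewrite tE eqxx; case: (site x k); rewrite /= ?mulr1 ?mulr0; congr (_ + _); lia.
by move=> j /negbTE jk; rewrite tE jk.
Qed.

Lemma bonds_hop x k : (0 < k < N)%N -> site x k != site x k.+1 ->
  bonds (hop x k) = bonds x +
    ((site x k)%:Z - (site x k.+1)%:Z) * ((site x k.+2)%:Z - (site x k.-1)%:Z).
Proof.
move=> kN neq; rewrite hopE // !bonds_toggle /=; try lia.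
rewrite !site_toggle ?eqxx; try lia.
rewrite (_ : (k.+1 == k) = false); last lia.
rewrite (_ : (k.+2 == k) = false); last lia.
case: (site x k) neq; case: (site x k.+1) => //= _;
case: (site x k.-1); case: (site x k.+2) => /=; lia.
Qed.

Lemma weight_hop w x k : (0 < k < N)%N -> site x k != site x k.+1 ->
  weight w (hop x k) = weight w x +
    ((site x k)%:Z - (site x k.+1)%:Z) * (w k.+1 - w k).
Proof.
move=> kN neq; rewrite hopE // !weight_toggle /=; try lia.
rewrite !site_toggle; try lia.
rewrite (_ : (k.+1 == k) = false); last lia.
case: (site x k) neq; case: (site x k.+1) => //= _; lia.
Qed.

(** There are finitely many configurations, so the number of those with a smaller value of [Q]
    serves as induction measure although [Q] may be negative. *)
Lemma potential_ind (Q : config N -> int) (P : config N -> Prop) :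
  (forall x, (forall y, Q y < Q x -> P y) -> P x) -> forall x, P x.
Proof.
move=> IH x; have [n] := ubnP #|[pred y | Q y < Q x]|.
elim: n x => // n IHn x lt_xn; apply: IH => y lt_yx; apply: IHn.
move: lt_xn; rewrite ltnS; apply: leq_trans; apply: proper_card; apply/properP; split.
  by apply/fintype.subsetP => z; rewrite !inE => zy; apply: lt_trans zy _.
by exists y; rewrite !inE ?ltxx.
Qed.

End Configurations.

Arguments site : simpl never.

(* The number of bonds gained by exchanging the occupations of [k] and [k.+1] when
   these differ, in a form without case distinctions. *)
Definition gain (f : nat -> bool) k : int :=
  ((f k && f k.+2) + (~~ f k && f k.-1))%N%:Z -
  ((f k && f k.-1) + (~~ f k && f k.+2))%N%:Z.

Ltac index_lia :=
  repeat match goal with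
  | H : forall _, _ |- _ => clear H
  | H : context [site] |- _ => clear H
  | H : is_true (@Order.lt _ _ _ _) |- _ => clear H
  | H : is_true (@Order.le _ _ _ _) |- _ => clear H
  end; lia.

Ltac decide_eqs := repeat match goal with |- context [@eq_op ?T ?i ?j] =>
  first [rewrite (_ : @eq_op T i j = false); [|index_lia]
        |rewrite (_ : @eq_op T i j = true); [|index_lia]] end.

Ltac decide_nat := repeat match goal with
  | |- context [leq ?i ?j] => first [rewrite (_ : leq i j = true); [|index_lia]
                                    |rewrite (_ : leq i j = false); [|index_lia]]
  | |- context [@eq_op ?T ?i ?j] =>
      first [rewrite (_ : @eq_op T i j = false); [|index_lia]
            |rewrite (_ : @eq_op T i j = true); [|index_lia]] end;
  rewrite /= ?(andbF, andbT, orbF, orbT) /= ?(addn0, add0n, subrr, subr0, sub0r) //=.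

Ltac bools := repeat match goal with |- context [site ?x ?k] =>
  case: (site x k); rewrite ?(andbF, andbT, implybT) //= end.

(** * Jumps, their exponents, and packed configurations *)

Section Landscape.
Variables (R : realType) (N : nat) (a b : R).
Hypotheses (N_ge5 : (5 <= N)%N) (a_gt1 : (1 : R) < a) (b_gt1 : (1 : R) < b).
Ltac lra_ab := intros; have ? := a_gt1; have ? := b_gt1; lra.
Implicit Types (x y z w u : config N) (c d e : R).
Local Notation s := (@site N).

Lemma intrN1 : (-1)%:~R = -1 :> R.
Proof. by rewrite mulrN1z. Qed.

(* Exponents of the rates are measured in units of [kappa / 2], with [a = muL / kappa] and
   [b = - muR / kappa]. *)
Inductive jump x : config N -> R -> Prop :=
| jump_hop k : (0 < k < N)%N -> s x k != s x k.+1 ->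
    jump x (hop x k) (gain (s x) k)%:~R
| jump_left : jump x (toggle x 1) ((if s x 1 then -1 else 1) * (a + (s x 2)%:R))
| jump_right :
    jump x (toggle x N) ((if s x N then 1 else -1) * (b - (s x N.-1)%:R)).

Definition exits_le x e := forall y c, jump x y c -> c <= e.

Lemma jump_neq x y c : jump x y c -> x <> y.
Proof.
case=> [k kN neq|  | ] E.
- by move: neq; rewrite {1}E site_hop // eqxx eqxx.
- by have /= := congr1 (fun z => s z 1) E; rewrite site_toggle ?eqxx; [case: (s x 1)|index_lia].
- by have /= := congr1 (fun z => s z N) E; rewrite site_toggle ?eqxx; [case: (s x N)|index_lia].
Qed.

Lemma jump_sym x y c : jump x y c -> exists d, jump y x d.
Proof.
case=> [k kN neq|  | ].
- exists (gain (s (hop x k)) k)%:~R; rewrite -{2}(hopK x kN).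
  apply: jump_hop => //; rewrite !site_hop // !eqxx (_ : (k.+1 == k) = false); last index_lia.
  by rewrite eq_sym.
- have N1 : (0 < 1 <= N)%N by index_lia.
  by eexists; rewrite -{2}(toggleK x N1); apply: jump_left.
- have NN : (0 < N <= N)%N by index_lia.
  by eexists; rewrite -{2}(toggleK x NN); apply: jump_right.
Qed.

Lemma gain_le1 f k : gain f k <= 1.
Proof. rewrite /gain; lia. Qed.

Lemma exits_leI x e (g : int) :
  (forall k, (0 < k < N)%N -> s x k != s x k.+1 -> gain (s x) k <= g) ->
  g%:~R <= e ->
  (if s x 1 then -1 else 1) * (a + (s x 2)%:R) <= e ->
  (if s x N then 1 else -1) * (b - (s x N.-1)%:R) <= e ->
  exits_le x e.
Proof.
move=> gain_le ge le_l le_r y c [k kN neq| |//]; last by [].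
by apply: le_trans ge; rewrite ler_int; apply: gain_le.
Qed.

Lemma left_removal x : s x 1 ->
  (if s x 1 then -1 else 1) * (a + (s x 2)%:R) <= - a :> R.
Proof. by move->; case: (s x 2) => /=; lra. Qed.

Lemma right_creation x : ~~ s x N ->
  (if s x N then 1 else -1) * (b - (s x N.-1)%:R) = (s x N.-1)%:R - b.
Proof. by move/negbTE ->; lra. Qed.

Lemma right_removal x : s x N ->
  (if s x N then 1 else -1) * (b - (s x N.-1)%:R) = b - (s x N.-1)%:R.
Proof. by move ->; lra. Qed.

(* With site 1 occupied and site N vacant both reservoirs act at a negative exponent. *)
Lemma exits_le_driven x (g : int) : s x 1 -> ~~ s x N ->
  (forall k, (0 < k < N)%N -> s x k != s x k.+1 -> gain (s x) k <= g) ->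
  -1 <= g -> (g < 0 -> ~~ s x N.-1) -> exits_le x g%:~R.
Proof.
move=> x1 xN gain_le g_ge g_neg; apply: (exits_leI gain_le) => //.
  apply: le_trans (left_removal x1) _.
  by have : -1 <= g%:~R :> R; [rewrite -intrN1 ler_int | lra_ab].
(* Beside an occupied [N.-1], creation at [N] has exponent [1 - b], negative but possibly above -1;
   this is what the last hypothesis excludes. *)
rewrite right_creation //; case: (ltP g 0) => [/g_neg/negbTE ->|g0] /=.
  by have : -1 <= g%:~R :> R; [rewrite -intrN1 ler_int | lra_ab].
by have : 0 <= g%:~R :> R; [rewrite ler0z | case: (s x N.-1) => /=; lra_ab].
Qed.

(* Blocks, and gaps other than the last one, have length at least three: then every
   exchange costs a bond, and the fastest continuation is to undo it. *)
Definition packed x : Prop :=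
  [/\ s x 1 && s x 2 && s x 3,
      forall k, (s x k && ~~ s x k.+1) ==> (~~ s x k.+2 && ~~ s x k.+3)
    & forall k, (0 < k)%N -> (~~ s x k && s x k.+1) ==> (s x k.+2 && s x k.+3)].

Lemma packed_rise x k : packed x -> (0 < k)%N -> (~~ s x k && s x k.+1) ==>
  [&& (3 < k)%N, ~~ s x k.-1, ~~ s x k.-2, s x k.+2 & s x k.+3].
Proof.
case=> x123 fall rise k0; move: (rise k k0) x123.
case: k k0 => [|[|[|[|k]]]] //= _; try by bools.
by move: (fall k.+3) (fall k.+2); bools.
Qed.

Lemma packed_fall x k : packed x -> (s x k && ~~ s x k.+1) ==>
  [&& (2 < k)%N, s x k.-1, s x k.-2, ~~ s x k.+2 & ~~ s x k.+3].
Proof.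
case=> x123 fall rise; move: (fall k) x123; case: k => [|[|[|k]]] /=; try by bools.
by move: (rise k.+2 isT) (rise k.+1 isT); bools.
Qed.

Lemma packed_gain x k : packed x -> (0 < k < N)%N -> s x k != s x k.+1 ->
  gain (s x) k = -1.
Proof.
move=> px /andP[k0 _]; rewrite /gain.
move: (@packed_fall x k px) (@packed_rise x k px k0).
by case: (2 < k)%N => //=; case: (3 < k)%N => //=; bools.
Qed.

(* The hopped pair may only hop back; every other exchange gains no bond. *)
Lemma packed_hop_gain x k j : packed x -> (0 < k < N)%N -> s x k != s x k.+1 ->
  (0 < j < N)%N -> s (hop x k) j != s (hop x k) j.+1 ->
  gain (s (hop x k)) j = 1 /\ j = k \/ gain (s (hop x k)) j <= 0 /\ j <> k.
Proof.
move=> px kN neq jN; have hE i := @site_hop N x k i kN.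
have [->|jk] := eqVneq j k.
  left; split=> //; have := packed_gain px kN neq; move: neq.
  by rewrite /gain !hE; decide_eqs; bools.
move=> neqj; right; split; last by apply/eqP.
have gj := packed_gain px jN.
have rise i := @packed_rise x i px; have fall i := @packed_fall x i px.
have [jk1|jk1] := eqVneq k j.+1.
  subst k; move: neqj neq (rise j.+1 isT) (fall j.+1); rewrite /gain !hE; decide_eqs.
  by rewrite /=; bools.
have [jk2|jk2] := eqVneq j k.+1.
  subst j; have k0 : (0 < k)%N by lia.
  move: neqj neq (rise k k0) (fall k); rewrite /gain !hE; decide_eqs.
  by rewrite /=; bools.
have [jk3|jk3] := eqVneq k j.+2.
  subst k; move: neqj neq (rise j.+2 isT) (fall j.+2); rewrite /gain !hE; decide_eqs.
  by rewrite /=; bools.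
have [jk4|jk4] := eqVneq j k.+2.
  subst j; have k0 : (0 < k)%N by lia.
  move: neqj neq (rise k k0) (fall k); rewrite /gain !hE; decide_eqs.
  by rewrite /=; bools.
move: neqj; rewrite /gain !hE; decide_eqs => /gj; rewrite /gain; bools.
Qed.

(** * Levels, cuts, and the spread of flow *)

Variable h : config N -> R.
(* The large-deviation form of the balance of probability flow across a cut. *)
Hypothesis cut : forall (A : config N -> Prop) x y c, jump x y c -> ~ A x -> A y ->
  exists z w d, [/\ A z, ~ A w, jump z w d & h x + c <= h z + d].
Hypothesis h_le0 : forall x, h x <= 0.

Lemma inflow_le (A : config N -> Prop) x y c e : jump x y c -> ~ A x -> A y ->
  (forall z w d, A z -> ~ A w -> jump z w d -> h z + d <= e) -> h x + c <= e.
Proof.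
move=> xy Ax Ay out; have [z [w [d [Az Aw zw]]]] := cut xy Ax Ay.
by move/le_trans; apply; apply: out zw.
Qed.

(** The cut around [y] alone. *)
Lemma inflow_exits_le x y c e : jump x y c -> exits_le y e -> h x + c <= h y + e.
Proof.
move=> xy ye; apply: (inflow_le (A := fun z => z = y) xy) => //.
  exact: jump_neq xy.
by move=> z w d -> _ /ye; rewrite lerD2l.
Qed.

(** The threshold bears on the flow [h x + c] of each jump, not on the exponent [c]: a slow exit
    from a high level qualifies. *)
Inductive reach (t : R) u : config N -> Prop :=
| reach_refl : reach t u u
| reach_step x y c : reach t u x -> jump x y c -> t <= h x + c -> reach t u y.

Lemma reach_enter t u x (A : config N -> Prop) : reach t u x -> ~ A u -> A x ->
  exists y z c, [/\ ~ A y, A z, jump y z c & t <= h y + c].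
Proof.
elim=> [//|y z c uy IH yz le_t] Au Az.
by have [/(IH Au)//|Ay] := EM (A y); exists y, z, c.
Qed.

Lemma reach_leave t u x (A : config N -> Prop) : reach t u x -> ~ A u -> A x ->
  exists y z c, [/\ A y, ~ A z, jump y z c & t <= h y + c].
Proof.
move=> ux Au Ax; have [y [z [c [Ay Az yz tyc]]]] := reach_enter ux Au Ax.
have [y' [z' [d [? ? ? le_d]]]] := cut yz Ay Az.
by exists y', z', d; split=> //; apply: le_trans le_d.
Qed.

(** Away from the start, flow of exponent at least [t] enters [x], hence leaves it, and a jump of
    largest exponent carries the maximum. Nothing need enter the start itself, whence the
    disjunction. *)
Lemma reach_fastest t u x y c : reach t u x -> x <> u \/ t <= h u + c ->
  jump x y c -> exits_le x c -> reach t u y.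
Proof.
move=> ux start xy xc; apply: reach_step (ux) (xy) _.
have [xu|/eqP xu] := eqVneq x u.
  by case: start; rewrite xu // => /(_ erefl).
have uN : ~ (u = x) by move=> E; apply: xu.
have [y' [z [d [-> _ /xc dc le_d]]]] := reach_leave (A := fun z => z = x) ux uN erefl.
by apply: le_trans le_d _; rewrite lerD2l.
Qed.

(** * Basins of grounded configurations *)

Definition grounded u : Prop := [/\ packed u, ~~ s u N.-1 & ~~ s u N].

(* When the gap at the right end has exactly two sites, filling it from the right
   produces further configurations that relax to [u]. *)
Definition base u x : Prop :=
  x = u \/ s u N.-2 /\ (x = toggle u N.-1 \/ x = toggle (toggle u N.-1) N).

(** Besides the base: a particle spilled in at [N], and everything one exchange away from the base.
    The set must contain all fast returns, so that only exits at [h u - 2] or below remain. *)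
Definition basin u x : Prop :=
  x = toggle u N \/ exists2 z, base u z &
    x = z \/ exists k, [/\ (0 < k < N)%N, s z k != s z k.+1 & x = hop z k].

Let N1S : N.-1.+1 = N. Proof. index_lia. Qed.
Let N2S : N.-2.+1 = N.-1. Proof. index_lia. Qed.
Let okN : (0 < N <= N)%N. Proof. index_lia. Qed.
Let okN1 : (0 < N.-1 <= N)%N. Proof. index_lia. Qed.
Let hopN1 : (0 < N.-1 < N)%N. Proof. index_lia. Qed.

Lemma packed_extend u y : packed u -> s u N.-2 -> ~~ s u N.-1 -> ~~ s u N ->
  (forall k, (k <= N.-2)%N -> s y k = s u k) -> s y N.-1 -> packed y.
Proof.
move=> pu u2 u1 uN yE y1; case: (pu) => u123 fall rise; split.
- by rewrite !yE //; index_lia.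
- move=> k; apply/implyP => /andP[yk yk1].
  have [le_k|gt_k] := leqP k N.-2; last first.
    by rewrite !site_out //; index_lia.
  have kN2 : k <> N.-2 by move=> E; move: yk1; rewrite E N2S y1.
  have := fall k; rewrite -(yE k) // -(yE k.+1) ?yk ?yk1 /=; last index_lia.
  case/andP=> uk2 uk3.
  have kN3 : k.+2 <> N.-1.
    move=> E; have E2 : k.+1 = N.-2 by index_lia.
    by move: yk1; rewrite E2 yE ?leqnn ?u2.
  have kN4 : k.+3 <> N.-1.
    move=> E; have E2 : k.+2 = N.-2 by index_lia.
    by move: uk2; rewrite E2 u2.
  have [k5|k5] := leqP k.+3 N.-2; first by rewrite !yE ?uk2 //; index_lia.
  exfalso; index_lia.
- move=> k k0; apply/implyP => /andP[yk yk1].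
  have [gt_k|le_k] := ltnP N.-2 k.
    have [E|?] := eqVneq k N.-1; first by move: yk; rewrite E y1.
    by move: yk1; rewrite site_out //; index_lia.
  have kN2 : k <> N.-2 by move=> E; move: yk; rewrite E yE ?u2.
  have := rise k k0; rewrite -(yE k) // -(yE k.+1) ?(negbTE yk) ?yk1 /=; last index_lia.
  case/andP=> uk2 uk3.
  have k3 := site_bound uk3.
  have k4 : k.+3 <> N by move=> E; rewrite E (negbTE uN) in uk3.
  have k5 : k.+3 <> N.-1 by move=> E; rewrite E (negbTE u1) in uk3.
  by rewrite !yE ?uk2 //; index_lia.
Qed.

Lemma packed_base u z : grounded u -> base u z -> packed z.
Proof.
case=> pu u1 uN [->//|[u2 zE]].
have tE k : s (toggle u N.-1) k = if k == N.-1 then true else s u k.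
  by rewrite site_toggle // u1.
have ttE k : s (toggle (toggle u N.-1) N) k =
    if k == N then true else if k == N.-1 then true else s u k.
  by rewrite site_toggle // !tE (_ : (N == N.-1) = false) ?(negbTE uN) //; index_lia.
case: zE => ->; apply: (packed_extend pu u2 u1 uN).
- by move=> k kN; rewrite tE ifF //; index_lia.
- by rewrite tE eqxx.
- by move=> k kN; rewrite ttE !ifF //; index_lia.
- by rewrite ttE eqxx if_same.
Qed.

Lemma packed_exits_le u : packed u -> ~~ s u N.-1 -> ~~ s u N -> exits_le u (-1).
Proof.
move=> pu u1 uN; rewrite -intrN1; apply: exits_le_driven => //.
- by case: pu => /andP[/andP[]].
- by move=> k kN neq; rewrite packed_gain.
Qed.

Lemma spill_le u : grounded u -> h (toggle u N) <= h u - 1 - b.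
Proof.
case=> pu u1 uN.
have wu : jump (toggle u N) u b.
  have := jump_right (toggle u N); rewrite toggleK // !site_toggle // eqxx uN.
  by rewrite (_ : (N.-1 == N) = false) ?(negbTE u1) ?subr0 ?mul1r //; index_lia.
have := inflow_exits_le wu (packed_exits_le pu u1 uN); lra_ab.
Qed.

(** The spilled particle gains a bond only by attaching to a block that ends at [N.-2], a move that
    stays within the base. *)
Lemma spill_gain u k : grounded u -> (0 < k < N)%N ->
  s (toggle u N) k != s (toggle u N) k.+1 ->
  gain (s (toggle u N)) k <= 0 \/ k = N.-1 /\ s u N.-2.
Proof.
case=> pu u1 uN kN; have wE i := @site_toggle N u N i okN.
have [->|k1] := eqVneq k N.-1.
  case u2: (s u N.-2) => _; [by right|left].
  rewrite /gain !wE (_ : N.-1.+2 = N.+1) ?N1S; last index_lia.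
  by rewrite (_ : (N.-1 == N) = false) ?(negbTE u1) /= ?u2; decide_eqs; rewrite ?site_out; index_lia.
have [->|k2] := eqVneq k N.-2.
  have := packed_fall N.-2 pu.
  move=> fall neq; left; move: neq fall.
  rewrite /gain !wE N2S N1S.
  by decide_eqs; move: u1 uN; bools.
move=> neq; left; move: neq; have := @packed_gain u k pu kN.
rewrite /gain !wE; decide_eqs.
by move=> gk neq; rewrite (gk neq).
Qed.

Lemma packed_site12 u : packed u -> s u 1 /\ s u 2.
Proof. by case=> /andP[/andP[]]. Qed.

Lemma hop_last u : grounded u -> s u N.-2 ->
  hop (toggle u N.-1) N.-1 = toggle u N.
Proof.
case=> _ u1 uN _; apply: site_inj => k kN.
rewrite site_hop // N1S !site_toggle // eqxx.
rewrite (_ : (N == N.-1) = false); last index_lia.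
case: (k =P N.-1) => [->|_].
  by rewrite (_ : (N.-1 == N) = false) ?(negbTE u1) ?(negbTE uN) //; index_lia.
by rewrite (negbTE u1) (negbTE uN).
Qed.

(** From [toggle u N.-1] the last particle moves to [N] at exponent -1 and is removed there at
    exponent [b]. This flow enters [u], which emits at most [h u - 1]. *)
Lemma base_le u z : grounded u -> base u z -> h z <= h u.
Proof.
move=> gu; have [pu u1 uN] := gu; have spill := spill_le gu.
case=> [->//|[u2 zE]]; set v := toggle u N.-1 in zE.
have bv : base u v by right; split=> //; left.
have pv := packed_base gu bv; have [v01 _] := packed_site12 pv.
have v1 : s v N.-1 by rewrite site_toggle // eqxx u1.
have vN : ~~ s v N.
  by rewrite site_toggle // (_ : (N == N.-1) = false) //; index_lia.
have hv : h v <= h u.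
  have neq : s v N.-1 != s v N.-1.+1 by rewrite N1S v1.
  have := jump_hop hopN1 neq; rewrite hop_last // packed_gain // intrN1 => vw.
  have wb : exits_le (toggle u N) b.
    apply: (exits_leI (g := 1)).
    - by move=> *; apply: gain_le1.
    - by lra_ab.
    - apply: le_trans (left_removal _) _; last by lra_ab.
      rewrite site_toggle // ifF; last index_lia.
      by have [] := packed_site12 pu.
    - rewrite right_removal; last by rewrite site_toggle // eqxx.
      by case: (s (toggle u N) N.-1) => /=; lra_ab.
  have := inflow_exits_le vw wb; lra_ab.
case: zE => [->//|->].
have v0 : exits_le v 0.
  apply: (@exits_le_driven v 0) => // k kN neq.
  by rewrite packed_gain.
have vpN : s (toggle v N) N by rewrite site_toggle // eqxx.
have := jump_right (toggle v N); rewrite right_removal // toggleK // => vv.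
have := inflow_exits_le vv v0.
case: (s (toggle v N) N.-1) => /=; lra_ab.
Qed.

(** An intermediate set for a two-stage estimate: it emits at most [h u - 1], which bounds the
    levels of the remaining members of the basin, and these in turn bound the exits of the basin. *)
Definition core u x := x = toggle u N \/ base u x.

Lemma base_toggle u z : grounded u -> base u z -> core u (toggle z N).
Proof.
move=> gu [->|[u2 [|] ->]]; first by left.
  by right; right; split=> //; right.
by rewrite toggleK //; right; right; split=> //; left.
Qed.

Lemma core_exits u x y c : grounded u -> core u x -> ~ core u y -> jump x y c ->
  h x + c <= h u - 1.
Proof.
move=> gu; have [pu u1 uN] := gu; have spill := spill_le gu.
have [u01 u02] := packed_site12 pu.
case=> [->|bx] cy xy.
  case: xy cy => [k kN neq cy| _ |].
  - have [g0|[kE u2]] := spill_gain gu kN neq; last first.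
      case: cy; right; right; split=> //; left.
      by rewrite kE -hop_last // hopK.
    have : (gain (s (toggle u N)) k)%:~R <= 0 :> R by rewrite lerz0.
    by lra_ab.
  - have w1 : s (toggle u N) 1 by rewrite site_toggle // ifF //; index_lia.
    by have := left_removal w1; lra_ab.
  - by case; right; left; rewrite toggleK.
have hx := base_le gu bx; have px := packed_base gu bx.
case: xy cy => [k kN neq _| _ |].
- by rewrite packed_gain // intrN1; lra_ab.
- by have [x1 _] := packed_site12 px; have := left_removal x1; lra_ab.
- by case; apply: base_toggle.
Qed.

(** The exchange is undone at exponent 1, while the core emits at most [h u - 1]; the 2 is the sum
    of these two units. *)
Lemma satellite_le u z k : grounded u -> base u z -> (0 < k < N)%N ->
  s z k != s z k.+1 -> ~ core u (hop z k) -> h (hop z k) <= h u - 2.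
Proof.
move=> gu bz kN neq nc; have pz := packed_base gu bz.
have neq' : s (hop z k) k != s (hop z k) k.+1.
  by rewrite !site_hop // !eqxx (_ : (k.+1 == k) = false) 1?eq_sym //; index_lia.
have := jump_hop kN neq'; rewrite hopK //.
have [[-> _]|[_ //]] := packed_hop_gain pz kN neq kN neq'.
move=> xz; have cz : core u z by right.
have := inflow_le xz nc cz (fun x y c cx cy xy => core_exits gu cx cy xy).
by lra_ab.
Qed.

Lemma packed_site1 u : packed u -> s u 1 && s u 2.
Proof. by case=> /andP[]. Qed.

Lemma left_removal2 x : s x 1 && s x 2 ->
  (if s x 1 then -1 else 1) * (a + (s x 2)%:R) = - a - 1 :> R.
Proof. by case/andP=> -> -> /=; lra_ab. Qed.

Lemma packed_hop_site1 z k : packed z -> (0 < k < N)%N -> s z k != s z k.+1 ->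
  s (hop z k) 1.
Proof.
move=> pz kN; rewrite site_hop //; case: (pz) => z123 _ _.
by case: k kN z123 => [|[|[|k]]] //= _; bools.
Qed.

Lemma hop_toggle z k : (0 < k)%N -> (k.+1 < N)%N ->
  toggle (hop z k) N = hop (toggle z N) k.
Proof.
move=> k0 kN; apply: site_inj => j jN.
rewrite site_toggle // !site_hop; try index_lia.
rewrite !site_toggle //.
rewrite (_ : (N == k) = false) 1?(_ : (N == k.+1) = false); try index_lia.
rewrite (_ : (k.+1 == N) = false) 1?(_ : (k == N) = false); try index_lia.
case: (j =P N) => [->|//].
by rewrite (_ : (N == k) = false) 1?(_ : (N == k.+1) = false); try index_lia.
Qed.

(** Removal at [N] may have a positive exponent and must not count as an exit of the basin. *)
Lemma base_hop_toggle u z k : grounded u -> base u z -> (0 < k < N)%N ->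
  s z k != s z k.+1 -> s (hop z k) N -> core u (hop z k) \/ basin u (toggle (hop z k) N).
Proof.
move=> gu bz kN neq hN; have [pu u1 uN] := gu.
have [kE|k1] := eqVneq k.+1 N.
  have kE1 : k = N.-1 by rewrite -kE.
  case: bz neq hN => [->|[u2 [->|->]]].
  - by rewrite kE1 N1S (negbTE u1) (negbTE uN).
  - by move=> _ _; left; left; rewrite kE1 hop_last.
  - rewrite kE1 N1S !site_toggle // eqxx (_ : (N == N.-1) = false); last index_lia.
    rewrite (_ : (N.-1 == N) = false); last index_lia.
    by rewrite eqxx (negbTE u1) (negbTE uN).
have zN : s z N.
  by move: hN; rewrite site_hop // !ifF //; index_lia.
right; right; exists (toggle z N).
  case: bz zN => [->|[u2 [->|->]]]; first by rewrite (negbTE uN).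
    rewrite site_toggle // (_ : (N == N.-1) = false) ?(negbTE uN) //.
    by index_lia.
  by move=> _; rewrite toggleK //; right; split=> //; left.
right; exists k; split=> //; last by rewrite hop_toggle //; index_lia.
by rewrite !site_toggle // !ifF //; index_lia.
Qed.

Lemma basin_exits u x y c : grounded u -> basin u x -> ~ basin u y -> jump x y c ->
  h x + c <= h u - 2.
Proof.
move=> gu bx by_ xy; have [pu u1 uN] := gu; have spill := spill_le gu.
have cb z : core u z -> basin u z.
  by case=> [->|bz]; [left|right; exists z => //; left].
have [cx|ncx] := EM (core u x).
  have c2 : ~ core u y by move/cb.
  case: cx xy by_ => [->|bz] xy by_.
    case: xy by_ => [k kN neq by_| _ |].
    - have [g0|[kE u2]] := spill_gain gu kN neq; last first.
        case: by_; apply: cb; right; right; split=> //; left.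
        by rewrite kE -hop_last // hopK.
      have : (gain (s (toggle u N)) k)%:~R <= 0 :> R by rewrite lerz0.
      by lra_ab.
    - have [u01 _] := packed_site12 pu.
      have w1 : s (toggle u N) 1 by rewrite site_toggle // ifF //; index_lia.
      by have := left_removal w1; lra_ab.
    - by case; apply: cb; right; left; rewrite toggleK.
  have hx := base_le gu bz; have px := packed_base gu bz.
  case: xy by_ => [k kN neq| _ |].
  - by case; right; exists x => //; right; exists k.
  - by rewrite left_removal2 ?packed_site1 //; lra_ab.
  - by case; apply: cb; apply: base_toggle.
case: bx => [E|[z bz [E|[k [kN neq E]]]]]; first by case: ncx; left.
  by case: ncx; right; rewrite E.
rewrite {x}E in xy ncx *; have hx := satellite_le gu bz kN neq ncx.
have pz := packed_base gu bz.
case: xy by_ => [j jN neqj| _ | byN].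
- have [[_ ->]|[g0 _] _] := packed_hop_gain pz kN neq jN neqj.
    by case; rewrite hopK //; right; exists z => //; left.
  have : (gain (s (hop z k)) j)%:~R <= 0 :> R by rewrite lerz0.
  by lra_ab.
- by have := left_removal (packed_hop_site1 pz kN neq); lra_ab.
- case hN: (s (hop z k) N).
    by have [//|] := base_hop_toggle gu bz kN neq hN.
  rewrite mulN1r; case: (s (hop z k) N.-1) => /=; lra_ab.
Qed.

Lemma basin_inflow u x y c : grounded u -> ~ basin u x -> basin u y -> jump x y c ->
  h x + c <= h u - 2.
Proof.
move=> gu bx byy xy; apply: (inflow_le xy bx byy) => x' y' c' ? ?.
exact: basin_exits.
Qed.

(* Here the cut is the basin without the configurations touching site [N.-1] from the right. *)
Lemma fringe_lt u : grounded u -> s u N.-2 -> h (toggle u N.-1) < h u.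
Proof.
move=> gu u2; have [pu u1 uN] := gu; have spill := spill_le gu.
set v := toggle u N.-1; set w := toggle u N.
pose A x := x = u \/ x = w \/
  exists k, [/\ (0 < k < N)%N, s u k != s u k.+1 & x = hop u k].
have bv : base u v by right; split=> //; left.
have pv := packed_base gu bv.
have v1 : s v N.-1 by rewrite site_toggle // eqxx u1.
have vN : ~~ s v N.
  by rewrite site_toggle // (_ : (N == N.-1) = false) //; index_lia.
have v2 : s v N.-2 by rewrite site_toggle // ifF //; index_lia.
have Av : ~ A v.
  case=> [E|[E|[k [kN neq E]]]].
  - by move: v1; rewrite E (negbTE u1).
  - by move: vN; rewrite E site_toggle // eqxx uN.
  have [kE|k1] := eqVneq k N.-1.
    by move: neq; rewrite kE N1S (negbTE u1) (negbTE uN).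
  have [kE|k2] := eqVneq k N.-2.
    by move: v2; rewrite E kE site_hop ?eqxx ?N2S ?(negbTE u1) //; index_lia.
  move: v1; rewrite E site_hop // !ifF ?(negbTE u1) //; index_lia.
have neq : s v N.-1 != s v N.-1.+1 by rewrite N1S v1.
have := jump_hop hopN1 neq; rewrite hop_last // packed_gain // intrN1 => vw.
have Aw : A w by right; left.
(* [h u - 2] bounds the exits from [u] and from its exchanged neighbours; [h u - b] bounds an
   exchange gaining a bond out of [w], whose level is at most [h u - 1 - b]. *)
have [m [m_lt m2 mb]] : exists m, [/\ m < h u - 1, h u - 2 <= m & h u - b <= m].
  have [b2|b2] := leP b 2.
    by exists (h u - b); split; lra_ab.
  by exists (h u - 2); split; lra_ab.
suff : h v + -1 <= m by lra_ab.
apply: (inflow_le vw Av Aw) => x y c Ax Ay xy.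
have u12 := packed_site1 pu; have /andP[u01 _] := u12.
case: Ax xy Ay => [->|[->|[k [kN neqk ->]]]] xy Ay.
- case: xy Ay => [k kN neqk|_|].
  + by case; right; right; exists k.
  + by rewrite left_removal2 //; lra_ab.
  + by case; right; left.
- case: xy Ay => [k kN neqk|_|].
  + have : (gain (s w) k)%:~R <= (1 : int)%:~R :> R by rewrite ler_int gain_le1.
    by lra_ab.
  + have w1 : s w 1 by rewrite site_toggle // ifF //; index_lia.
    by have := left_removal w1; lra_ab.
  + by case; left; rewrite toggleK.
have sat : h (hop u k) <= h u - 2.
  have neqk' : s (hop u k) k != s (hop u k) k.+1.
    by rewrite !site_hop // !eqxx (_ : (k.+1 == k) = false) 1?eq_sym //; index_lia.
  have := jump_hop kN neqk'; rewrite hopK //.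
  have [[-> _]|[_ //]] := packed_hop_gain pu kN neqk kN neqk'.
  by move/inflow_exits_le => /(_ _ (packed_exits_le pu u1 uN)); lra_ab.
case: xy Ay => [j jN neqj|_|Ay].
- have [[_ ->]|[g0 _] _] := packed_hop_gain pu kN neqk jN neqj.
    by case; left; rewrite hopK.
  have : (gain (s (hop u k)) j)%:~R <= 0 :> R by rewrite lerz0.
  by lra_ab.
- by have := left_removal (packed_hop_site1 pu kN neqk); lra_ab.
- have hN : ~~ s (hop u k) N.
    rewrite site_hop // (_ : (N == k) = false); last index_lia.
    case: eqP => // E; have kE : k = N.-1 by rewrite E.
    by rewrite kE.
  by rewrite right_creation //; case: (s (hop u k) N.-1) => /=; lra_ab.
Qed.

(** Strictness is needed twice: a configuration of level 0 cannot lie in the basin of another one,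
    and the steps with at most one vacant site lie strictly below [h u] for the step [u] with
    two. *)
Lemma basin_lt u x : grounded u -> basin u x -> x <> u -> h x < h u.
Proof.
move=> gu bx xu; have spill := spill_le gu; have [pu u1 uN] := gu.
have [cx|ncx] := EM (core u x); last first.
  case: bx ncx xu => [->|[z bz [->|[k [kN neq ->]]]]] ncx xu.
  - by case: ncx; left.
  - by case: ncx; right.
  - by have := satellite_le gu bz kN neq ncx; lra_ab.
case: cx xu => [->|[->//|[u2 [|] -> _]]]; first by lra_ab.
  exact: fringe_lt.
apply: le_lt_trans (fringe_lt gu u2).
set v := toggle u N.-1.
have bv : base u v by right; split=> //; left.
have pv := packed_base gu bv; have /andP[v01 _] := packed_site1 pv.
have vN : ~~ s v N.
  by rewrite site_toggle // (_ : (N == N.-1) = false) //; index_lia.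
have v0 : exits_le v 0.
  by apply: (@exits_le_driven v 0) => // k kN neq; rewrite packed_gain.
have vpN : s (toggle v N) N by rewrite site_toggle // eqxx.
have := jump_right (toggle v N); rewrite right_removal // toggleK // => vv.
have := inflow_exits_le vv v0.
by case: (s (toggle v N) N.-1) => /=; lra_ab.
Qed.

(** * Steps with one travelling hole or particle *)

Local Notation step := (Defs.eta N).
(** In the ranges used, [vacancy p k] and [adatom p k] both carry [p] particles. The families meet:
    [vacancy p p.+1] and [adatom p p] are [step p], and [vacancy p p] is [adatom p p.+1]. *)
Definition vacancy p k : config N := of_site N (fun j => (j <= p.+1)%N && (j != k)).
Definition adatom p k : config N := of_site N (fun j => (j < p)%N || (j == k)).

Lemma site_vacancy p k j :
  s (vacancy p k) j = [&& (0 < j)%N, (j <= N)%N, (j <= p.+1)%N & j != k].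
Proof. by rewrite site_of_site -andbA. Qed.

Lemma site_adatom p k j :
  s (adatom p k) j = [&& (0 < j)%N, (j <= N)%N & (j < p)%N || (j == k)].
Proof. by rewrite site_of_site -andbA. Qed.

Lemma vacancy_hops p k j : (0 < j < N)%N -> (0 < k <= p)%N -> (p.+1 < N)%N ->
  s (vacancy p k) j != s (vacancy p k) j.+1 -> [|| j == k, j.+1 == k | j == p.+1].
Proof. move=> jN kp pN; rewrite !site_vacancy; index_lia. Qed.

Lemma gain_vacancyL p k : (1 < k <= p)%N -> (p.+1 < N)%N ->
  gain (s (vacancy p k)) k.-1 = (k == 2)%:Z.
Proof.
move=> kp pN; have [->|k2] := eqVneq k 2.
  by rewrite /gain !site_vacancy; decide_nat.
by rewrite /gain !site_vacancy; decide_nat.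
Qed.

Lemma gain_vacancyR p k : (1 < k < p)%N -> (p.+1 < N)%N -> gain (s (vacancy p k)) k = 0.
Proof. by move=> kp pN; rewrite /gain !site_vacancy; decide_nat. Qed.

Lemma gain_vacancy_front p k : (0 < k < p)%N -> (p.+1 < N)%N ->
  gain (s (vacancy p k)) p.+1 = -1.
Proof. by move=> kp pN; rewrite /gain !site_vacancy; decide_nat. Qed.

Lemma gain_vacancy1 p : (1 < p)%N -> (p.+1 < N)%N -> gain (s (vacancy p 1)) 1 = -1.
Proof. by move=> kp pN; rewrite /gain !site_vacancy; decide_nat. Qed.

Lemma gain_vacancy_last p : (1 < p)%N -> (p.+1 < N)%N ->
  gain (s (vacancy p p)) p = 1 /\ gain (s (vacancy p p)) p.+1 = 0.
Proof. by move=> kp pN; rewrite /gain !site_vacancy; decide_nat. Qed.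

Lemma hop_vacancyL p k : (1 < k <= p)%N -> (p.+1 < N)%N ->
  hop (vacancy p k) k.-1 = vacancy p k.-1.
Proof.
move=> kp pN; apply: site_inj => j jN; rewrite site_hop ?site_vacancy; last index_lia.
case: eqP => [->|?]; first by decide_nat.
by case: eqP => [->|?]; decide_nat.
Qed.

Ltac site_by_site := apply: site_inj => ? ?; rewrite ?site_hop ?site_toggle; try index_lia;
  do ?[case: eqP => [->|?]]; rewrite ?site_vacancy ?site_adatom ?site_eta;
  decide_nat; try index_lia.

Lemma hop_vacancyR p k : (0 < k <= p)%N -> (p < N)%N ->
  hop (vacancy p k) k = vacancy p k.+1.
Proof. by move=> kp pN; site_by_site. Qed.

Lemma vacancy_eta p : (0 < p)%N -> vacancy p p.+1 = step p.
Proof. by move=> p0; site_by_site. Qed.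

Lemma vacancy_adatom p : (0 < p)%N -> vacancy p p = adatom p p.+1.
Proof. by move=> p0; site_by_site. Qed.

Lemma hop_eta p : (0 < p < N)%N -> hop (step p) p = vacancy p p.
Proof. by move=> p0; site_by_site. Qed.

Lemma hop_vacancy_front p : (0 < p)%N -> (p.+1 < N)%N ->
  hop (vacancy p p) p.+1 = adatom p p.+2.
Proof. by move=> p0 pN; site_by_site. Qed.

Lemma toggle_vacancy1 p : (p < N)%N -> toggle (vacancy p 1) 1 = step p.+1.
Proof. by move=> pN; site_by_site. Qed.

Lemma adatom_eta p : (0 < p)%N -> adatom p p = step p.
Proof. by move=> p0; site_by_site. Qed.

Lemma hop_adatomL p k : (0 < p)%N -> (p < k <= N)%N ->
  hop (adatom p k) k.-1 = adatom p k.-1.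
Proof. by move=> p0 kN; site_by_site. Qed.

Lemma hop_adatomR p k : (0 < p)%N -> (p <= k < N)%N -> hop (adatom p k) k = adatom p k.+1.
Proof. by move=> p0 kN; site_by_site. Qed.

Lemma toggle_adatom p : (0 < p <= N)%N -> toggle (adatom p N) N = step p.-1.
Proof. by move=> pN; site_by_site. Qed.

Lemma toggle_eta p : (p < N)%N -> toggle (step p) N = adatom p.+1 N.
Proof. by move=> pN; site_by_site. Qed.

Lemma toggle_full : toggle (step N) N = step N.-1.
Proof. by site_by_site. Qed.

Lemma eta_hops p k : (0 < k < N)%N -> s (step p) k != s (step p) k.+1 -> k = p.
Proof. move=> kN; rewrite !site_eta; index_lia. Qed.

Lemma adatom_hops p k j : (0 < j < N)%N -> (p < k <= N)%N ->
  s (adatom p k) j != s (adatom p k) j.+1 -> [|| j.+1 == p, j.+1 == k | j == k].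
Proof. move=> jN kN; rewrite !site_adatom; index_lia. Qed.

Lemma gain_eta p : (1 < p < N)%N -> gain (s (step p)) p = -1.
Proof. by move=> pN; rewrite /gain !site_eta; decide_nat. Qed.

Lemma gain_adatom_base p k : (2 < p)%N -> (p.+1 < k <= N)%N ->
  gain (s (adatom p k)) p.-1 = -1.
Proof. by move=> p2 kN; rewrite /gain !site_adatom; decide_nat. Qed.

Lemma gain_adatom_base_near p : (2 < p < N)%N -> gain (s (adatom p p.+1)) p.-1 = 0.
Proof. by move=> p2; rewrite /gain !site_adatom; decide_nat. Qed.

Lemma gain_adatomL p k : (0 < p)%N -> (p.+1 < k <= N)%N ->
  gain (s (adatom p k)) k.-1 = 0.
Proof. by move=> p0 kN; rewrite /gain !site_adatom; decide_nat. Qed.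

Lemma gain_adatomR p k : (0 < p)%N -> (p.+1 < k < N)%N -> gain (s (adatom p k)) k = 0.
Proof. by move=> p0 kN; rewrite /gain !site_adatom; decide_nat. Qed.

Lemma grounded_step p : (2 < p < N.-1)%N -> grounded (step p).
Proof.
move=> pN; split; [|by rewrite site_eta; index_lia|by rewrite site_eta; index_lia].
by split=> [|k|k k0]; rewrite !site_eta; index_lia.
Qed.

Lemma exits_step_le p : (1 < p < N.-1)%N -> exits_le (step p) (-1).
Proof.
move=> pN; rewrite -intrN1; apply: exits_le_driven => //.
- by rewrite site_eta; index_lia.
- by rewrite site_eta; index_lia.
- by move=> k kN /eta_hops -> //; rewrite gain_eta //; index_lia.
- by rewrite site_eta; index_lia.
Qed.

Lemma exits_step_le0 p : (1 < p < N)%N -> exits_le (step p) 0.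
Proof.
move=> pN; apply: (@exits_le_driven (step p) 0) => //.
- by rewrite site_eta; index_lia.
- by rewrite site_eta; index_lia.
- by move=> k kN /eta_hops -> //; rewrite gain_eta //; index_lia.
Qed.

Lemma exits_vacancy_le0 p k : (2 < k < p)%N -> (p.+1 < N)%N -> exits_le (vacancy p k) 0.
Proof.
move=> kp pN; apply: (@exits_le_driven (vacancy p k) 0) => //.
- by rewrite site_vacancy; index_lia.
- by rewrite site_vacancy; index_lia.
- move=> j jN /vacancy_hops -/(_ jN) H.
  have /or3P[/eqP ->|/eqP jk|/eqP ->] : [|| j == k, j.+1 == k | j == p.+1].
  + by apply: H; index_lia.
  + by rewrite gain_vacancyR //; index_lia.
  + have -> : j = k.-1 by rewrite -jk.
    by rewrite gain_vacancyL; [rewrite (_ : (k == 2) = false) //; index_lia|index_lia|index_lia].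
  + by rewrite gain_vacancy_front //; index_lia.
Qed.

Lemma exits_adatom_le0 p k : (2 < p)%N -> (p.+1 < k < N)%N -> exits_le (adatom p k) 0.
Proof.
move=> p2 kN; apply: (@exits_le_driven (adatom p k) 0) => //.
- by rewrite site_adatom; index_lia.
- by rewrite site_adatom; index_lia.
- move=> j jN /adatom_hops -/(_ jN) H.
  have /or3P[/eqP jp|/eqP jk|/eqP ->] : [|| j.+1 == p, j.+1 == k | j == k].
  + by apply: H; index_lia.
  + have -> : j = p.-1 by rewrite -jp.
    by rewrite gain_adatom_base //; index_lia.
  + have -> : j = k.-1 by rewrite -jk.
    by rewrite gain_adatomL //; index_lia.
  + by rewrite gain_adatomR //; index_lia.
Qed.

Lemma basin_step p x : (2 < p < N.-1)%N -> basin (step p) x ->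
  [\/ x = adatom p.+1 N, exists2 q, (2 < q <= N)%N & x = step q
    | exists2 q, (2 < q < N)%N & x = vacancy q q].
Proof.
move=> pN; have base_step z : base (step p) z -> exists2 q, (2 < q <= N)%N & z = step q.
  case=> [->|[p2 zE]]; first by exists p => //; index_lia.
  have pE : p = N.-2 by move: p2; rewrite site_eta; index_lia.
  have vE : toggle (step p) N.-1 = step N.-1 by rewrite pE; site_by_site.
  case: zE => ->; rewrite vE.
    by exists N.-1 => //; index_lia.
  exists N; first by index_lia.
  by rewrite toggle_eta ?N1S ?adatom_eta //; index_lia.
case=> [->|[z /base_step[q qN ->] [->|[k [kN neq ->]]]]].
- by constructor 1; rewrite toggle_eta //; index_lia.
- by constructor 2; exists q.
- have kq := eta_hops kN neq; subst k.
  by constructor 3; exists q; [index_lia | rewrite hop_eta].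
Qed.

Lemma vacancy_notin_basin p q k : (2 < p < N.-1)%N -> (0 < k < q)%N -> (q.+1 < N)%N ->
  ~ basin (step p) (vacancy q k).
Proof.
move=> pN kq qN /(basin_step pN) H.
have v0 : s (vacancy q k) k = false by rewrite site_vacancy; index_lia.
have v1 : s (vacancy q k) k.+1 by rewrite site_vacancy; index_lia.
have v2 : s (vacancy q k) k.+2 by rewrite site_vacancy; index_lia.
case: H v0 v1 v2 => [->|[r rN ->]|[r rN ->]].
- by rewrite !site_adatom; index_lia.
- by rewrite !site_eta; index_lia.
- by rewrite !site_vacancy; index_lia.
Qed.

Lemma adatom_notin_basin p q k : (2 < p < N.-1)%N -> (0 < q)%N -> (q.+1 < k < N)%N ->
  ~ basin (step p) (adatom q k).
Proof.
move=> pN q0 kN /(basin_step pN) H.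
have v0 : s (adatom q k) k.-2 = false by rewrite site_adatom; index_lia.
have v1 : s (adatom q k) k.-1 = false by rewrite site_adatom; index_lia.
have v2 : s (adatom q k) k by rewrite site_adatom; index_lia.
case: H v0 v1 v2 => [->|[r rN ->]|[r rN ->]].
- by rewrite !site_adatom; index_lia.
- by rewrite !site_eta; index_lia.
- by rewrite !site_vacancy; index_lia.
Qed.

Lemma jump_hopE x y k (g : int) : (0 < k < N)%N -> s x k != s x k.+1 ->
  hop x k = y -> gain (s x) k = g -> jump x y g%:~R.
Proof. by move=> kN neq <- <-; apply: jump_hop. Qed.

Lemma jump_step p : (1 < p < N)%N -> jump (step p) (vacancy p p) (-1).
Proof.
move=> pN; rewrite -intrN1; apply: (@jump_hopE _ _ p).
- by index_lia.
- by rewrite !site_eta; decide_nat.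
- by rewrite hop_eta //; index_lia.
- by rewrite gain_eta.
Qed.

Lemma jump_vacancy_step p : (1 < p)%N -> (p.+1 < N)%N -> jump (vacancy p p) (step p) 1.
Proof.
move=> p1 pN; apply: (@jump_hopE _ _ p 1).
- by index_lia.
- by rewrite !site_vacancy; decide_nat.
- by rewrite hop_vacancyR ?vacancy_eta //; index_lia.
- by have [] := gain_vacancy_last p1 pN.
Qed.

Lemma jump_vacancyR p k : (1 < k < p)%N -> (p.+1 < N)%N ->
  jump (vacancy p k) (vacancy p k.+1) 0.
Proof.
move=> kp pN; apply: (@jump_hopE _ _ k 0).
- by index_lia.
- by rewrite !site_vacancy; decide_nat.
- by rewrite hop_vacancyR //; index_lia.
- exact: gain_vacancyR.
Qed.

Lemma jump_vacancyL p k : (1 < k <= p)%N -> (p.+1 < N)%N ->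
  jump (vacancy p k) (vacancy p k.-1) (k == 2)%:R.
Proof.
move=> kp pN; apply: (@jump_hopE _ _ k.-1 (k == 2)%:Z).
- by index_lia.
- by rewrite !site_vacancy; decide_nat.
- exact: hop_vacancyL.
- exact: gain_vacancyL.
Qed.

Lemma jump_vacancy1 p : (0 < p)%N -> (p.+1 < N)%N -> jump (vacancy p 1) (step p.+1) (a + 1).
Proof.
move=> p0 pN; have := jump_left (vacancy p 1).
by rewrite toggle_vacancy1 ?site_vacancy; try index_lia; decide_nat; rewrite ?mul1r ?site_vacancy; decide_nat.
Qed.

Lemma jump_adatomL p k : (0 < p)%N -> (p.+1 < k <= N)%N ->
  jump (adatom p k) (adatom p k.-1) 0.
Proof.
move=> p0 kN; apply: (@jump_hopE _ _ k.-1 0).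
- by index_lia.
- by rewrite !site_adatom; decide_nat.
- by rewrite hop_adatomL //; index_lia.
- exact: gain_adatomL.
Qed.

Lemma jump_adatomR p k : (0 < p)%N -> (p.+1 < k < N)%N ->
  jump (adatom p k) (adatom p k.+1) 0.
Proof.
move=> p0 kN; apply: (@jump_hopE _ _ k 0).
- by index_lia.
- by rewrite !site_adatom; decide_nat.
- by rewrite hop_adatomR //; index_lia.
- exact: gain_adatomR.
Qed.

Lemma jump_vacancy_adatom p : (1 < p)%N -> (p.+1 < N)%N ->
  jump (vacancy p p) (adatom p p.+2) 0.
Proof.
move=> p1 pN; apply: (@jump_hopE _ _ p.+1 0).
- by index_lia.
- by rewrite !site_vacancy; decide_nat.
- by rewrite hop_vacancy_front //; index_lia.
- by have [] := gain_vacancy_last p1 pN.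
Qed.

Lemma jump_adatomN p : (0 < p < N)%N -> jump (adatom p N) (step p.-1) b.
Proof.
move=> pN; have := jump_right (adatom p N).
rewrite toggle_adatom; last index_lia.
rewrite !site_adatom; decide_nat.
by rewrite ?subr0 mul1r.
Qed.

(** * Upper bounds on the levels of the travelling configurations *)

Lemma h_vacancy_last p : (2 < p)%N -> (p.+1 < N)%N -> h (vacancy p p) <= h (step p) - 2.
Proof.
move=> p2 pN; have /inflow_exits_le H := @jump_vacancy_step p (ltnW p2) pN.
have := H _ (exits_step_le _); rewrite (_ : (1 < p < N.-1)%N); last index_lia.
by move=> /(_ isT); lra_ab.
Qed.

Lemma h_vacancy_le p k : (2 < p)%N -> (p.+1 < N)%N -> (1 < k <= p)%N ->
  h (vacancy p k) <= h (step p) - 2.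
Proof.
move=> p2 pN; have [n] := ubnP (p - k); elim: n k => // n IH k kn kp.
have [->|kp'] := eqVneq k p; first exact: h_vacancy_last.
have jR : jump (vacancy p k) (vacancy p k.+1) 0.
  by apply: jump_vacancyR => //; index_lia.
have pN1 : (2 < p < N.-1)%N by index_lia.
have [kE|kE] := eqVneq k.+1 p.
  (* [vacancy p p] has an exit at exponent 1, so the cut around it alone would lose a unit; the cut
     around the basin does not. *)
  suff : h (vacancy p k) + 0 <= h (step p) - 2 by lra_ab.
  apply: basin_inflow jR; first exact: grounded_step.
    by apply: vacancy_notin_basin; index_lia.
  rewrite kE; right; exists (step p); first by left.
  right; exists p; split; [by index_lia|by rewrite !site_eta; decide_nat|].
  by rewrite hop_eta //; index_lia.
have k1 : h (vacancy p k.+1) <= h (step p) - 2 by apply: IH; index_lia.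
have := inflow_exits_le jR (@exits_vacancy_le0 p k.+1 _ pN).
rewrite (_ : (2 < k.+1 < p)%N); last index_lia.
by move=> /(_ isT); lra_ab.
Qed.

Lemma h_adatom_le p k : (2 < p < N.-1)%N -> (p < k < N)%N ->
  h (adatom p k) <= h (step p) - 2.
Proof.
move=> pN; elim: k => // k IH kN.
have [<-|kp] := eqVneq p k.
  by rewrite -vacancy_adatom; [apply: h_vacancy_last; index_lia|index_lia].
have jL : jump (adatom p k.+1) (adatom p k) 0.
  by apply: (@jump_adatomL p k.+1); index_lia.
have [kE|kE] := eqVneq k p.+1.
  suff : h (adatom p k.+1) + 0 <= h (step p) - 2 by lra_ab.
  apply: basin_inflow jL; first exact: grounded_step.
    by apply: adatom_notin_basin; index_lia.
  rewrite kE -vacancy_adatom; last index_lia.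
  right; exists (step p); first by left.
  right; exists p; split; [by index_lia|by rewrite !site_eta; decide_nat|].
  by rewrite hop_eta //; index_lia.
have k1 : h (adatom p k) <= h (step p) - 2 by apply: IH; index_lia.
have := inflow_exits_le jL (@exits_adatom_le0 p k _ _).
rewrite (_ : (2 < p)%N); last index_lia.
rewrite (_ : (p.+1 < k < N)%N); last index_lia.
by move=> /(_ isT isT); lra_ab.
Qed.

Lemma h_vacancy1_le p : (1 < p)%N -> (p.+1 < N)%N -> h (vacancy p 1) <= - a - 1.
Proof.
move=> p1 pN; have p0 : (0 < p)%N by index_lia.
have := inflow_exits_le (jump_vacancy1 p0 pN) (@exits_step_le0 p.+1 _).
rewrite pN (_ : (1 < p.+1)%N) // => /(_ isT).
by have := h_le0 (step p.+1); lra_ab.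
Qed.

Lemma h_adatomN_le p : (2 < p < N)%N -> h (adatom p N) <= - 1 - b.
Proof.
move=> pN; have p0 : (0 < p < N)%N by index_lia.
have := inflow_exits_le (jump_adatomN p0) (@exits_step_le p.-1 _).
rewrite (_ : (1 < p.-1 < N.-1)%N); last index_lia.
by move=> /(_ isT); have := h_le0 (step p.-1); lra_ab.
Qed.

(** With sites 1 and 3 occupied, the particle at 1 moves to 2 at exponent 1 and site 1 is refilled,
    which leads into the basin of [step 3], where inflow is at most -2. This extra unit is what
    excludes [p = 2]. *)
Lemma h_vacancy22_le : h (vacancy 2 2) <= - 3.
Proof.
have N3 : (3 < N)%N by index_lia.
have j1 := @jump_vacancy1 2 isT N3.
have g3 : grounded (step 3) by apply: grounded_step; index_lia.
have out : ~ basin (step 3) (vacancy 2 1) by apply: vacancy_notin_basin; index_lia.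
have in3 : basin (step 3) (step 3) by right; exists (step 3); left.
have := basin_inflow g3 out in3 j1.
have e1 : exits_le (vacancy 2 1) (a + 1).
  apply: (exits_leI (g := 1)).
  - by move=> *; apply: gain_le1.
  - by lra_ab.
  - by rewrite !site_vacancy; decide_nat; rewrite mul1r.
  - rewrite right_creation; first by case: (s _ _) => /=; lra_ab.
    by rewrite site_vacancy; index_lia.
have j2 : jump (vacancy 2 2) (vacancy 2 1) 1 by apply: (@jump_vacancyL 2 2).
have := inflow_exits_le j2 e1.
by have := h_le0 (step 3); lra_ab.
Qed.

(* The configurations met when single particles or single holes travel between steps. *)
Definition island x : Prop :=
  [\/ exists2 p, (1 < p <= N)%N & x = step p,
      exists p k, [/\ (1 < p)%N, (p.+1 < N)%N, (0 < k <= p)%N & x = vacancy p k]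
    | exists p k, [/\ (2 < p < N)%N, (p < k <= N)%N & x = adatom p k]].

(** * Flow out of the island *)

Lemma island_step p : (1 < p <= N)%N -> island (step p).
Proof. by move=> pN; constructor 1; exists p. Qed.

Lemma island_vacancy p k : (1 < p)%N -> (p.+1 < N)%N -> (0 < k <= p.+1)%N ->
  island (vacancy p k).
Proof.
move=> p1 pN; have [->|kp] := eqVneq k p.+1 => kN.
  by rewrite vacancy_eta; [apply: island_step|]; index_lia.
by constructor 2; exists p, k; split=> //; index_lia.
Qed.

Lemma island_adatom p k : (2 < p <= N)%N -> (p <= k <= N)%N -> island (adatom p k).
Proof.
move=> pN; have [->|kp] := eqVneq k p => kN.
  by rewrite adatom_eta; [apply: island_step|]; index_lia.
by constructor 3; exists p, k; split=> //; index_lia.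
Qed.

Lemma step_exits p y c : (1 < p <= N)%N -> ~ island y -> jump (step p) y c ->
  h (step p) + c < - 2.
Proof.
move=> pN ny xy; case: xy ny => [k kN neq| _|].
- have kp := eta_hops kN neq; subst k; case; rewrite hop_eta //.
  have [pE|pE] := eqVneq p N.-1; last by apply: island_vacancy; index_lia.
  by rewrite vacancy_adatom; [apply: island_adatom|]; index_lia.
- rewrite left_removal2; last by rewrite !site_eta; index_lia.
  by have := h_le0 (step p); lra_ab.
- case; have [->|pE] := eqVneq p N.
    by rewrite toggle_full; apply: island_step; index_lia.
  by rewrite toggle_eta; [apply: island_adatom|]; index_lia.
Qed.

Lemma right_creation_lt0 x : ~~ s x N ->
  (if s x N then 1 else -1) * (b - (s x N.-1)%:R) < 0 :> R.
Proof. by move/right_creation ->; case: (s x N.-1) => /=; lra_ab. Qed.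

Lemma left_removal_lt x : s x 1 ->
  (if s x 1 then -1 else 1) * (a + (s x 2)%:R) < - 1 :> R.
Proof. by move/left_removal; lra_ab. Qed.

Lemma vacancy1_exits p y c : (1 < p)%N -> (p.+1 < N)%N -> ~ island y ->
  jump (vacancy p 1) y c -> h (vacancy p 1) + c < - 2.
Proof.
move=> p1 pN ny xy; have hx := h_vacancy1_le p1 pN.
case: xy ny => [j jN neq| |] ny.
- have /or3P[/eqP jE|/eqP jE|/eqP jE] : [|| j == 1, j.+1 == 1 | j == p.+1].
  + by apply: vacancy_hops neq; index_lia.
  + by rewrite jE gain_vacancy1 // intrN1; lra_ab.
  + by exfalso; index_lia.
  + by rewrite jE gain_vacancy_front ?intrN1; try index_lia; lra_ab.
- by case: ny; rewrite toggle_vacancy1; [apply: island_step|]; index_lia.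
- have := @right_creation_lt0 (vacancy p 1).
  by rewrite {1}site_vacancy (_ : (N <= p.+1)%N = false) ?andbF; [move=> /(_ isT); lra_ab|index_lia].
Qed.

Lemma vacancy_exits p k y c : (1 < p)%N -> (p.+1 < N)%N -> (1 < k <= p)%N -> ~ island y ->
  jump (vacancy p k) y c -> h (vacancy p k) + c < - 2.
Proof.
move=> p1 pN kp ny xy.
have hx2 : h (vacancy p k) <= - 2.
  have [pE|pE] := eqVneq p 2.
    have kE : k = 2 by index_lia.
    by have := h_vacancy22_le; rewrite pE kE; lra_ab.
  have := @h_vacancy_le p k; have := h_le0 (step p).
  by rewrite pN kp (_ : (2 < p)%N); [move=> ? /(_ isT isT isT); lra_ab|index_lia].
case: xy ny => [j jN neq| |] ny.
- have /or3P[/eqP jE|/eqP jE|/eqP jE] : [|| j == k, j.+1 == k | j == p.+1].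
  + by apply: vacancy_hops neq; index_lia.
  + case: ny; rewrite jE hop_vacancyR; try index_lia.
    by apply: island_vacancy; index_lia.
  + have -> : j = k.-1 by rewrite -jE.
    case: ny; rewrite (_ : j = k.-1); last by rewrite -jE.
    by rewrite hop_vacancyL //; apply: island_vacancy; index_lia.
  have [kE|kE] := eqVneq k p; last first.
    by rewrite jE gain_vacancy_front ?intrN1; try index_lia; lra_ab.
  have [pE|pE] := eqVneq p 2; last first.
    case: ny; rewrite jE kE hop_vacancy_front; try index_lia.
    by apply: island_adatom; index_lia.
  (* For [p = 2] this exchange, of exponent 0, leaves a lone particle at site 1 and so leads off the
     island; the bound -3 makes it slow enough. *)
  have [_] := gain_vacancy_last p1 pN; rewrite jE kE => ->.
  by have := h_vacancy22_le; rewrite pE mulr0z; lra_ab.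
- have v1 : s (vacancy p k) 1 by rewrite site_vacancy; index_lia.
  by have := left_removal_lt v1; lra_ab.
- have vN : ~~ s (vacancy p k) N by rewrite site_vacancy; index_lia.
  by have := right_creation_lt0 vN; lra_ab.
Qed.

Lemma adatom_exits p k y c : (2 < p < N.-1)%N -> (p.+1 < k < N)%N -> ~ island y ->
  jump (adatom p k) y c -> h (adatom p k) + c < - 2.
Proof.
move=> pN kp ny xy.
have hx2 : h (adatom p k) <= - 2.
  have := @h_adatom_le p k pN; have := h_le0 (step p).
  by rewrite (_ : (p < k < N)%N); [move=> ? /(_ isT); lra_ab|index_lia].
case: xy ny => [j jN neq| |] ny.
- have /or3P[/eqP jE|/eqP jE|/eqP jE] : [|| j.+1 == p, j.+1 == k | j == k].
  + by apply: adatom_hops neq; index_lia.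
  + have -> : j = p.-1 by rewrite -jE.
    by rewrite gain_adatom_base ?intrN1; try index_lia; lra_ab.
  + case: ny; rewrite (_ : j = k.-1); last by rewrite -jE.
    by rewrite hop_adatomL; [apply: island_adatom|index_lia|]; index_lia.
  + case: ny; rewrite jE hop_adatomR; try index_lia.
    by apply: island_adatom; index_lia.
- have v1 : s (adatom p k) 1 by rewrite site_adatom; index_lia.
  by have := left_removal_lt v1; lra_ab.
- have vN : ~~ s (adatom p k) N by rewrite site_adatom; index_lia.
  by have := right_creation_lt0 vN; lra_ab.
Qed.

Lemma adatomN_exits p y c : (2 < p < N)%N -> ~ island y ->
  jump (adatom p N) y c -> h (adatom p N) + c < - 2.
Proof.
move=> pN ny xy; have hx := h_adatomN_le pN.
case: xy ny => [j jN neq| |] ny.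
- have /or3P[/eqP jE|/eqP jE|/eqP jE] : [|| j.+1 == p, j.+1 == N | j == N].
  + by apply: adatom_hops neq; index_lia.
  + have -> : j = p.-1 by rewrite -jE.
    have : (gain (s (adatom p N)) p.-1)%:~R <= 0 :> R.
      rewrite lerz0; have [pE|pE] := eqVneq p.+1 N.
        by have := @gain_adatom_base_near p; rewrite pE => -> //; index_lia.
      by rewrite gain_adatom_base //; index_lia.
    by lra_ab.
  + case: ny; rewrite (_ : j = N.-1); last by rewrite -jE.
    by rewrite hop_adatomL; [apply: island_adatom|index_lia|]; index_lia.
  + by exfalso; index_lia.
- have v1 : s (adatom p N) 1 by rewrite site_adatom; index_lia.
  by have := left_removal_lt v1; lra_ab.
- by case: ny; rewrite toggle_adatom; [apply: island_step|]; index_lia.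
Qed.

Lemma island_exits x y c : island x -> ~ island y -> jump x y c -> h x + c < - 2.
Proof.
case=> [[p pN ->]|[p [k [p1 pN kp ->]]]|[p [k [pN kN ->]]]]; first exact: step_exits.
  have [->|k1] := eqVneq k 1; first exact: vacancy1_exits.
  by apply: vacancy_exits => //; index_lia.
have [->|kE] := eqVneq k N; first exact: adatomN_exits.
have [kp|kp] := eqVneq k p.+1; last by apply: adatom_exits; index_lia.
rewrite kp -vacancy_adatom; last index_lia.
by apply: vacancy_exits; index_lia.
Qed.

(* The weights make every relaxation below decrease the potential: a lost bond counts more
   than one displacement by a site, but less than two. *)
Definition slope k : int := 5 - 3 * (N.-1 - k)%N%:Z + (N.-2 < k)%N%:Z.
Definition potential x : int := weight slope x - 5 * bonds x.

(** Here [N >= 5] enters: the slope at site 1 is at most -4. *)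
Lemma potential_fill x : ~~ s x 1 ->
  potential (toggle x 1) <= potential x - 4 - 5 * (s x 2)%:Z.
Proof.
move=> x1; have ok1 : (0 < 1 <= N)%N by index_lia.
rewrite /potential weight_toggle // bonds_toggle // (negbTE x1) /=.
have -> : slope 1 = 5 - 3 * (N.-2)%:Z by rewrite /slope; decide_nat; index_lia.
case: (s x 2) => /=; index_lia.
Qed.

(** The slope 6 at site [N] exceeds the 5 of the bond that a removal may break. *)
Lemma potential_removal x : s x N ->
  potential (toggle x N) <= potential x - 6 + 5 * (s x N.-1)%:Z.
Proof.
move=> xN; rewrite /potential weight_toggle // bonds_toggle // xN.
have -> : slope N = 6 by rewrite /slope; index_lia.
by rewrite (@site_out _ x N.+1) //; case: (s x N.-1) => /=; index_lia.
Qed.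

Lemma potential_hopL x k : (0 < k < N.-1)%N -> ~~ s x k -> s x k.+1 ->
  potential (hop x k) <= potential x - 3 - 5 * gain (s x) k.
Proof.
move=> kN xk xk1; have kN' : (0 < k < N)%N by index_lia.
rewrite /potential weight_hop ?bonds_hop ?(negbTE xk) ?xk1 //.
have -> : gain (s x) k = (s x k.-1)%:Z - (s x k.+2)%:Z by rewrite /gain (negbTE xk).
have : slope k.+1 - slope k >= 3 by rewrite /slope; index_lia.
move: (slope _) (slope _) => A B /=; index_lia.
Qed.

Lemma potential_hopR x k : (0 < k < N)%N -> s x k -> ~~ s x k.+1 ->
  potential (hop x k) <= potential x + 4 - 5 * gain (s x) k.
Proof.
move=> kN xk xk1; rewrite /potential weight_hop ?bonds_hop ?(negbTE xk1) ?xk //.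
have -> : gain (s x) k = (s x k.+2)%:Z - (s x k.-1)%:Z by rewrite /gain xk /= !addn0.
have : slope k.+1 - slope k <= 4 by rewrite /slope; index_lia.
move: (slope _) (slope _) => A B /=; index_lia.
Qed.

Lemma potential_hopR_low x k : (0 < k < N.-2)%N -> s x k -> ~~ s x k.+1 ->
  potential (hop x k) <= potential x + 3 - 5 * gain (s x) k.
Proof.
move=> kN xk xk1; have kN' : (0 < k < N)%N by index_lia.
rewrite /potential weight_hop ?bonds_hop ?(negbTE xk1) ?xk //.
have -> : gain (s x) k = (s x k.+2)%:Z - (s x k.-1)%:Z by rewrite /gain xk /= !addn0.
have : slope k.+1 - slope k <= 3 by rewrite /slope; index_lia.
move: (slope _) (slope _) => A B /=; index_lia.
Qed.

(** The last two slopes are equal, so moving into [N] costs at most the lost bond, 5, which the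
    removal that follows repays with 6. *)
Lemma potential_hopR_last x : s x N.-1 -> ~~ s x N ->
  potential (hop x N.-1) <= potential x - 5 * gain (s x) N.-1.
Proof.
move=> xk xk1; have neq : s x N.-1 != s x N.-1.+1 by rewrite N1S xk.
rewrite /potential (weight_hop _ hopN1 neq) (bonds_hop hopN1 neq) N1S (negbTE xk1) xk.
have -> : gain (s x) N.-1 = (s x N.-1.+2)%:Z - (s x N.-1.-1)%:Z by rewrite /gain xk /= !addn0.
rewrite N1S.
have -> : slope N = slope N.-1.
  by rewrite /slope; index_lia.
move: (slope _) => A /=; index_lia.
Qed.

Lemma potential_hop_gain x k : (0 < k < N)%N -> s x k != s x k.+1 -> gain (s x) k = 1 ->
  potential (hop x k) < potential x.
Proof.
move=> kN neq g; case xk: (s x k) neq => [] /= xk1.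
  have := potential_hopR kN xk; rewrite g => /(_ _); move: xk1.
  by case: (s x k.+1) => // _ /(_ isT); index_lia.
have xk1' : s x k.+1 by move: xk1; case: (s x k.+1).
have [kE|kE] := eqVneq k N.-1.
  have neq : s x k != s x k.+1 by rewrite xk xk1'.
  rewrite /potential (weight_hop _ kN neq) (bonds_hop kN neq) kE N1S.
  have -> : slope N = slope N.-1 by rewrite /slope; index_lia.
  move: g xk xk1'; rewrite kE N1S => + xk xk1'; rewrite /gain xk xk1' /= !add0n .
  by rewrite N1S subrr mulr0 addr0 sub0r; index_lia.
have := @potential_hopL x k _ (negbT xk) xk1'; rewrite g (_ : (0 < k < N.-1)%N); last index_lia.
by move=> /(_ isT); index_lia.
Qed.

(** * Descent of the potential along flow of exponent at least -2 *)

Lemma fast u x y c : h u = 0 -> reach (-2) u x -> jump x y c -> exits_le x c -> - 2 <= c ->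
  reach (-2) u y.
Proof.
move=> hu ux xy xc c2; apply: reach_fastest ux _ xy xc.
by right; rewrite hu add0r.
Qed.

(** Creation at site 1 has exponent above 1 and beats every exchange; its only rival is a removal at
    [N]. *)
Lemma fill_exits x : ~~ s x 1 -> ~~ s x N \/ b - (s x N.-1)%:R <= a + (s x 2)%:R ->
  jump x (toggle x 1) (a + (s x 2)%:R) /\ exits_le x (a + (s x 2)%:R).
Proof.
move=> /negbTE x1 xN; split.
  by have := jump_left x; rewrite x1 mul1r.
have s2 : 0 <= (s x 2)%:R :> R by case: (s x 2).
apply: (exits_leI (g := 1)).
- by move=> *; apply: gain_le1.
- by lra_ab.
- by rewrite x1 mul1r.
case sN: (s x N) xN => /=; first by case=> // ?; rewrite mul1r.
by move=> _; have := @right_creation_lt0 x; rewrite sN => /(_ isT); lra_ab.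
Qed.

Lemma removal_exits x : s x N ->
  s x 1 \/ a + (s x 2)%:R <= b - (s x N.-1)%:R ->
  (forall k, (0 < k < N)%N -> s x k != s x k.+1 ->
    (gain (s x) k)%:~R <= b - (s x N.-1)%:R) ->
  jump x (toggle x N) (b - (s x N.-1)%:R) /\ exits_le x (b - (s x N.-1)%:R).
Proof.
move=> xN x1 gx; split.
  by have := jump_right x; rewrite xN mul1r.
move=> y c [k kN neq| |]; first exact: gx.
- case s1: (s x 1) x1 => /=; last by case=> // ?; rewrite mul1r.
  move=> _; have := @left_removal_lt x; rewrite s1 => /(_ isT).
  by case: (s x N.-1) => /=; lra_ab.
- by rewrite xN mul1r.
Qed.

(** A reservoir site in the wrong state is corrected quickly. Only removal beside an occupied
    [N.-1], of exponent [b - 1], can be slower than an exchange that gains a bond; in that case the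
    exchange is followed instead. *)
Lemma descend_undriven u x : h u = 0 -> reach (-2) u x -> ~~ s x 1 || s x N ->
  exists2 y, reach (-2) u y & potential y < potential x.
Proof.
move=> hu ux xE.
have fill : ~~ s x 1 -> ~~ s x N \/ b - (s x N.-1)%:R <= a + (s x 2)%:R ->
    exists2 y, reach (-2) u y & potential y < potential x.
  move=> x1 xN; have [xy ex] := fill_exits x1 xN.
  exists (toggle x 1).
    by apply: fast ux xy ex _ => //; case: (s x 2) => /=; lra_ab.
  by have := potential_fill x1; case: (s x 2) => /=; index_lia.
have empty : s x N -> s x 1 \/ a + (s x 2)%:R <= b - (s x N.-1)%:R ->
  (forall k, (0 < k < N)%N -> s x k != s x k.+1 ->
    (gain (s x) k)%:~R <= b - (s x N.-1)%:R) ->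
    exists2 y, reach (-2) u y & potential y < potential x.
  move=> xN x1 gx; have [xy ex] := removal_exits xN x1 gx.
  exists (toggle x N).
    by apply: fast ux xy ex _ => //; case: (s x N.-1) => /=; lra_ab.
  by have := potential_removal xN; case: (s x N.-1) => /=; index_lia.
have gain1 k : (gain (s x) k)%:~R <= 1 :> R.
  by rewrite -[1]/((1 : int)%:~R) ler_int gain_le1.
have [x1|x1] := boolP (s x 1); last first.
  have [xN|xN] := boolP (s x N); last by apply: fill => //; left.
  have [ab|ab] := leP (b - (s x N.-1)%:R) (a + (s x 2)%:R).
    by apply: fill => //; right.
  apply: empty => // [|k kN neq]; first by right; apply: ltW.
  by have := gain1 k; move: ab; case: (s x 2) => /=; lra_ab.
have xN : s x N by move: xE; rewrite x1.
have [fastN|slowN] := leP 1 (b - (s x N.-1)%:R).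
  apply: empty => // [|k kN neq]; first by left.
  by have := gain1 k; lra_ab.
have [[k [kN neq g]]|no_gain] :=
    EM (exists k, [/\ (0 < k < N)%N, s x k != s x k.+1 & gain (s x) k = 1]).
  exists (hop x k); last exact: potential_hop_gain.
  apply: fast ux (jump_hop kN neq) _ _ => //; rewrite g.
    apply: (exits_leI (g := 1)) => //.
    - by move=> *; apply: gain_le1.
    - by have := left_removal_lt x1; lra_ab.
    - by rewrite right_removal //; apply: ltW.
  by lra_ab.
apply: empty => // [|k kN neq]; first by left.
have : (gain (s x) k)%:~R <= 0 :> R.
  rewrite lerz0; have := gain_le1 (s x) k.
  by case: (gain (s x) k =P 1) => g; [case: no_gain; exists k|move: g; index_lia].
by case: (s x N.-1) => /=; lra_ab.
Qed.

(** A weakening of [packed] that admits blocks and inner gaps of length two; it still makes every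
    exchange cost a bond. *)
Definition clustered x : Prop := s x 1 && s x 2 /\
  forall k, (0 < k)%N -> (~~ s x k && s x k.+1) ==> (~~ s x k.-1 && s x k.+2).

Lemma clustered_gain x k : clustered x -> (0 < k < N)%N -> s x k != s x k.+1 ->
  gain (s x) k = -1.
Proof.
case=> x12 rise kN; rewrite /gain; move: x12 (rise k.+1 isT).
case: k kN => [//|[|k]] kN /=; first by move: (rise 1%N isT); bools.
by move: (rise k.+1 isT) (rise k.+2 isT) => /=; bools.
Qed.

Lemma clustered_exits_le x : clustered x -> ~~ s x N.-1 -> ~~ s x N -> exits_le x (-1).
Proof.
move=> cx x1 xN; rewrite -intrN1; apply: exits_le_driven => //.
  by case: cx => /andP[].
by move=> k kN neq; rewrite clustered_gain.
Qed.

Lemma exits_le1 x : s x 1 -> ~~ s x N -> exits_le x 1.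
Proof.
by move=> x1 xN; apply: (@exits_le_driven x 1) => // *; apply: gain_le1.
Qed.

(* [x] may be exchanging quickly with [toggle x N], so the flow is bounded across the cut
   around the pair. *)
Lemma descend_tail u x : h u = 0 -> reach (-2) u x -> clustered x -> s x N.-1 ->
  ~~ s x N -> exists2 y, reach (-2) u y & potential y < potential x.
Proof.
move=> hu ux cx x1 xN; set x' := toggle x N; set w := hop x N.-1.
have neq : s x N.-1 != s x N.-1.+1 by rewrite N1S x1.
have gx := clustered_gain cx hopN1 neq.
have x2 : s x N.-2.
  by move: gx; rewrite /gain x1 N1S (@site_out _ x N.+1) //=; case: (s x N.-2).
have x'E k : s x' k = if k == N then true else s x k by rewrite site_toggle // xN.
have [/andP[x01 x02] rise] := cx.
have cx' : clustered x'.
  split; first by rewrite !x'E; decide_eqs; rewrite x01 x02.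
  move=> k k0; have [lt_Nk|le_kN] := ltnP N k.
    by rewrite (@site_out _ x' k.+1) ?andbF //; index_lia.
  rewrite !x'E; have [->|kN] := eqVneq k N; first by [].
  have [->|kN1] := eqVneq k N.-1.
    by rewrite N1S eqxx x1.
  have [->|kN2] := eqVneq k N.-2.
    by rewrite N2S N1S eqxx x2.
  by decide_eqs; apply: rise.
have xx' : jump x' x (b - 1).
  have := jump_right x'; rewrite right_removal; last by rewrite x'E eqxx.
  by rewrite x'E (_ : (N.-1 == N) = false) ?x1 ?toggleK //; index_lia.
have x0 : exits_le x 0.
  by apply: (@exits_le_driven x 0) => // k kN nk; rewrite clustered_gain.
have hx' : h x' < h x by have := inflow_exits_le xx' x0; lra_ab.
(* The pair emits at most [h x - 1], yet flow of exponent -2 passes through it. If the start [u]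
   lies in the pair it must be [x], since [h x' < h x]. *)
have hx : - 1 <= h x.
  have [->|xu] := EM (x = u); first by lra_ab.
  have [x'u|x'u] := EM (x' = u).
    by have := h_le0 x; move: hx'; rewrite x'u; lra_ab.
  have uA : ~ (u = x \/ u = x') by case=> E; [apply: xu|apply: x'u].
  have [y [z [c [Ay Az yz]]]] := reach_leave (A := fun z => z = x \/ z = x') ux uA (or_introl erefl).
  suff : h y + c <= h x - 1 by lra_ab.
  case: Ay yz Az => -> [k kN nk| |] Az.
  - by rewrite clustered_gain // intrN1; lra_ab.
  - by have := left_removal_lt x01; lra_ab.
  - by case: Az; right.
  - by rewrite clustered_gain // intrN1; lra_ab.
  - have x'1 : s x' 1 by rewrite x'E; decide_eqs.
    by have := left_removal_lt x'1; lra_ab.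
  - by case: Az; left; rewrite /x' toggleK.
have uw : reach (-2) u w.
  by apply: reach_step ux (jump_hop hopN1 neq) _; rewrite gx intrN1; lra_ab.
have wE k : s w k = if k == N.-1 then false else if k == N then true else s x k.
  by rewrite site_hop // N1S (negbTE xN) x1.
have wN : s w N by rewrite wE eqxx; decide_eqs.
have w1 : s w N.-1 = false by rewrite wE eqxx.
have w01 : s w 1 by rewrite wE; decide_eqs.
have [] := removal_exits wN (or_introl w01).
  move=> k kN nk; rewrite w1 subr0; apply: (@le_trans _ _ (1 : int)%:~R); last by lra_ab.
  by rewrite ler_int gain_le1.
rewrite w1 subr0 => ww ew; exists (toggle w N).
  by apply: fast uw ww ew _ => //; lra_ab.
have := potential_removal wN; have := potential_hopR_last x1 xN.
by rewrite gx w1 -/w; index_lia.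
Qed.

(** A first block of length two shifts right by one site and site 1 is refilled; the potential
    changes by at most 8, -2 and -9. *)
Lemma descend_first_pair u x : h u = 0 -> reach (-2) u x -> clustered x ->
  ~~ s x N.-1 -> ~~ s x N -> ~~ s x 3 ->
  exists2 y, reach (-2) u y & potential y < potential x.
Proof.
move=> hu ux cx xN1 xN x3; have [/andP[x1 x2] _] := cx.
have k2 : (0 < 2 < N)%N by index_lia.
have k1 : (0 < 1 < N)%N by index_lia.
have nx : s x 2 != s x 3 by rewrite x2 (negbTE x3).
have gx := clustered_gain cx k2 nx.
have := jump_hop k2 nx; rewrite gx intrN1 => xy.
have {}uy : reach (-2) u (hop x 2).
  by apply: fast ux xy (clustered_exits_le cx xN1 xN) _ => //; lra_ab.
have px := @potential_hopR_low x 2; move: px; rewrite gx x2 x3.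
rewrite (_ : (0 < 2 < N.-2)%N); last index_lia.
move=> /(_ isT isT isT) py.
set y := hop x 2 in xy uy py.
have yE k : s y k = if k == 2 then false else if k == 3 then true else s x k.
  by rewrite site_hop // (negbTE x3) x2.
have y1 : s y 1 by rewrite yE.
have y2 : ~~ s y 2 by rewrite yE.
have yN : ~~ s y N by rewrite yE; decide_eqs.
have ny : s y 1 != s y 2 by rewrite y1 (negbTE y2).
have gy : gain (s y) 1 = 1 by rewrite /gain y1 site0 !yE.
have := jump_hop k1 ny; rewrite gy => yz.
have uz : reach (-2) u (hop y 1).
  by apply: fast uy yz (exits_le1 y1 yN) _ => //; lra_ab.
have pz := @potential_hopR_low y 1; move: pz; rewrite gy y1 y2.
rewrite (_ : (0 < 1 < N.-2)%N); last index_lia.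
move=> /(_ isT isT isT) pz.
set z := hop y 1 in yz uz pz.
have zE k : s z k = if k == 1 then false else if k == 2 then true else s y k.
  by rewrite site_hop // (negbTE y2) y1.
have z1 : ~~ s z 1 by rewrite zE.
have z2 : s z 2 by rewrite zE.
have zN : ~~ s z N by rewrite zE; decide_eqs.
have [zv ez] := fill_exits z1 (or_introl zN).
exists (toggle z 1).
  by apply: fast uz zv ez _ => //; rewrite z2 /=; lra_ab.
by have := potential_fill z1; rewrite z2 /=; move: py pz; index_lia.
Qed.

Lemma clustered_rise x r : clustered x -> s x 3 -> ~~ s x N.-1 -> ~~ s x N ->
  (0 < r)%N -> ~~ s x r -> s x r.+1 ->
  [&& (4 < r)%N, (r.+3 < N)%N, ~~ s x r.-1 & s x r.+2].
Proof.
case=> x12 rise x3 x1 xN r0 xr xr1; have := rise r r0; rewrite xr xr1 /=.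
case/andP=> xrm xr2; rewrite xrm xr2 !andbT.
have rN := site_bound xr2.
have rN1 : r.+2 <> N by move=> E; move: xr2; rewrite E (negbTE xN).
have rN2 : r.+2 <> N.-1 by move=> E; move: xr2; rewrite E (negbTE x1).
apply/andP; split; last by index_lia.
by case: r r0 xr xr1 xrm {xr2 rN rN1 rN2} => [|[|[|[|[|r]]]]] //=; move: x12 x3; bools.
Qed.

(** No exit of [x] exceeds -1, so detaching the first particle of a block to the left is a fastest
    jump. The 2 is a lost bond, 5, minus a displacement, 3. *)
Lemma clustered_peel u x r : h u = 0 -> reach (-2) u x -> clustered x -> s x 3 ->
  ~~ s x N.-1 -> ~~ s x N -> (0 < r)%N -> ~~ s x r -> s x r.+1 ->
  [/\ reach (-2) u (hop x r), exits_le (hop x r) 1, jump x (hop x r) (-1) &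
      potential (hop x r) <= potential x + 2].
Proof.
move=> hu ux cx x3 x1 xN r0 xr xr1.
have /and4P[r4 rN xrm xr2] := clustered_rise cx x3 x1 xN r0 xr xr1.
have rN' : (0 < r < N)%N by index_lia.
have nx : s x r != s x r.+1 by rewrite xr1 (negbTE xr).
have gx := clustered_gain cx rN' nx.
have := jump_hop rN' nx; rewrite gx intrN1 => xy.
split=> //.
- by apply: fast ux xy (clustered_exits_le cx x1 xN) _ => //; lra_ab.
- have [/andP[x01 _] _] := cx.
  by apply: exits_le1; rewrite site_hop // !ifF //; index_lia.
- have := @potential_hopL x r; rewrite gx xr xr1.
  rewrite (_ : (0 < r < N.-1)%N); last index_lia.
  by move=> /(_ isT isT isT); index_lia.
Qed.

(** Once the first particle of a block has moved left, the second one rejoins it if the block had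
    length two, and it touches the preceding block if the gap had length two. Either way the bond is
    regained. *)
Lemma descend_narrow u x r : h u = 0 -> reach (-2) u x -> clustered x -> s x 3 ->
  ~~ s x N.-1 -> ~~ s x N -> (0 < r)%N -> ~~ s x r -> s x r.+1 ->
  ~~ s x r.+3 || s x r.-2 ->
  exists2 y, reach (-2) u y & potential y < potential x.
Proof.
move=> hu ux cx x3 x1 xN r0 xr xr1 narrow.
have /and4P[r4 rN xrm xr2] := clustered_rise cx x3 x1 xN r0 xr xr1.
have rN' : (0 < r < N)%N by index_lia.
have [uy ey _ py] := clustered_peel hu ux cx x3 x1 xN r0 xr xr1.
set y := hop x r in uy ey py.
have yE k : s y k = if k == r then true else if k == r.+1 then false else s x k.
  by rewrite site_hop // (negbTE xr) xr1.
have [k [kr ny yk gy]] : exists k, [/\ (0 < k < N.-1)%N, ~~ s y k, s y k.+1 & gain (s y) k = 1].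
  case/orP: narrow => xr3.
  - exists r.+1; split; [index_lia| | |]; rewrite /gain ?yE; decide_eqs => //.
    by rewrite (negbTE xr3).
  - exists r.-1; split; [index_lia| | |]; rewrite /gain ?yE; decide_eqs; rewrite ?(negbTE xrm) //.
    by rewrite xr3.
have kN' : (0 < k < N)%N by index_lia.
have neq : s y k != s y k.+1 by rewrite yk (negbTE ny).
have := jump_hop kN' neq; rewrite gy => yz.
exists (hop y k); first by apply: fast uy yz ey _ => //; lra_ab.
have := potential_hopL kr ny yk; rewrite gy; move: py; index_lia.
Qed.

(** The peeled particle moves on at exponent 0, while its return may have exponent 1, so following
    fastest jumps does not help. From the start itself, of level 0, the level after peeling is at
    least -2, and that suffices; at a reached configuration of unknown level it would not. *)
Lemma descend_wide u r : h u = 0 -> clustered u -> s u 3 -> ~~ s u N.-1 -> ~~ s u N ->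
  (0 < r)%N -> ~~ s u r -> s u r.+1 -> ~~ s u r.-2 ->
  exists2 y, reach (-2) u y & potential y < potential u.
Proof.
move=> hu cu u3 u1 uN r0 ur ur1 urm2.
have /and4P[r4 rN urm ur2] := clustered_rise cu u3 u1 uN r0 ur ur1.
have rN' : (0 < r < N)%N by index_lia.
have [uy ey xy py] := clustered_peel hu (reach_refl _ u) cu u3 u1 uN r0 ur ur1.
set y := hop u r in uy ey py xy.
have yE k : s y k = if k == r then true else if k == r.+1 then false else s u k.
  by rewrite site_hop // (negbTE ur) ur1.
have kr : (0 < r.-1 < N.-1)%N by index_lia.
have ny : ~~ s y r.-1 by rewrite yE; decide_eqs.
have yk : s y r.-1.+1 by rewrite yE; decide_eqs.
have gy : gain (s y) r.-1 = 0.
  by rewrite /gain !yE; decide_eqs; rewrite (negbTE urm) (negbTE urm2).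
have kN' : (0 < r.-1 < N)%N by index_lia.
have neq : s y r.-1 != s y r.-1.+1 by rewrite yk (negbTE ny).
have := jump_hop kN' neq; rewrite gy => yz.
exists (hop y r.-1).
  apply: reach_step uy yz _.
  by have := inflow_exits_le xy ey; rewrite hu; lra_ab.
have := potential_hopL kr ny yk; rewrite gy; move: py; index_lia.
Qed.

Lemma descend_driven u x : h u = 0 -> reach (-2) u x -> s x 1 -> ~~ s x N ->
  ~ clustered x -> exists2 y, reach (-2) u y & potential y < potential x.
Proof.
move=> hu ux x1 xN ncx.
have [[k [kN neq g]]|no_gain] :=
    EM (exists k, [/\ (0 < k < N)%N, s x k != s x k.+1 & gain (s x) k = 1]).
  exists (hop x k); last exact: potential_hop_gain.
  apply: fast ux (jump_hop kN neq) _ _ => //; rewrite g; last by lra_ab.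
  exact: exits_le1.
have gain_le0 k : (0 < k < N)%N -> s x k != s x k.+1 -> gain (s x) k <= 0.
  move=> kN neq; have := gain_le1 (s x) k.
  by case: (gain (s x) k =P 1) => g; [case: no_gain; exists k|move: g; index_lia].
have x0 : exits_le x 0 by apply: (@exits_le_driven x 0).
have [[k [kN xk xk1 g]]|no_left] :=
    EM (exists k, [/\ (0 < k < N)%N, ~~ s x k, s x k.+1 & gain (s x) k = 0]).
  have neq : s x k != s x k.+1 by rewrite xk1 (negbTE xk).
  have kN1 : (0 < k < N.-1)%N.
    have [kE|] := eqVneq k N.-1; last by index_lia.
    by move: xk1; rewrite kE N1S (negbTE xN).
  have := jump_hop kN neq; rewrite g => xy.
  exists (hop x k); first by apply: fast ux xy x0 _ => //; lra_ab.
  by have := potential_hopL kN1 xk xk1; rewrite g; index_lia.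
have rise k : (0 < k)%N -> (~~ s x k && s x k.+1) ==> (~~ s x k.-1 && s x k.+2).
  move=> k0; apply/implyP => /andP[xk xk1].
  have kN : (0 < k < N)%N by have := site_bound xk1; index_lia.
  have neq : s x k != s x k.+1 by rewrite xk1 (negbTE xk).
  have := gain_le0 k kN neq.
  have : gain (s x) k <> 0 by move=> g; case: no_left; exists k.
  by rewrite /gain (negbTE xk) /= !add0n; bools.
(* Clustering can now fail only at site 2: the lone particle at site 1 moves there and site 1 is
   refilled. *)
have x2 : ~~ s x 2 by apply/negP => x2; apply: ncx; split=> //; rewrite x1.
have k1 : (0 < 1 < N)%N by index_lia.
have neq : s x 1 != s x 2 by rewrite x1 (negbTE x2).
have g : gain (s x) 1 = 0.
  move: (rise 2%N isT); rewrite x1 x2 /=.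
  by have := gain_le0 1%N k1 neq; rewrite /gain x1 site0 /=; case: (s x 3).
have := jump_hop k1 neq; rewrite g => xy.
have uy : reach (-2) u (hop x 1) by apply: fast ux xy x0 _ => //; lra_ab.
have := @potential_hopR_low x 1; rewrite g x1 x2.
rewrite (_ : (0 < 1 < N.-2)%N); last index_lia.
move=> /(_ isT isT isT) py.
set y := hop x 1 in uy py.
have yE k : s y k = if k == 1 then false else if k == 2 then true else s x k.
  by rewrite site_hop // (negbTE x2) x1.
have y1 : ~~ s y 1 by rewrite yE.
have y2 : s y 2 by rewrite yE.
have yN : ~~ s y N by rewrite yE; decide_eqs.
have [yz ez] := fill_exits y1 (or_introl yN).
exists (toggle y 1); first by apply: fast uy yz ez _ => //; rewrite y2 /=; lra_ab.
by have := potential_fill y1; rewrite y2; move: py; index_lia.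
Qed.

Lemma clustered_packed x : clustered x -> s x 3 ->
  (forall r, (0 < r)%N -> ~~ s x r -> s x r.+1 -> s x r.+3 && ~~ s x r.-2) -> packed x.
Proof.
case=> x12 rise x3 wide.
have wideb r : (0 < r)%N -> (~~ s x r && s x r.+1) ==> (s x r.+3 && ~~ s x r.-2).
  by move=> r0; apply/implyP => /andP[]; apply: wide.
split; first by rewrite x12.
- by move=> k; move: (rise k.+1 isT) (wideb k.+2 isT) => /=; bools.
- by move=> k k0; move: (rise k k0) (wideb k k0); bools.
Qed.

Lemma descend u x : h u = 0 -> reach (-2) u x -> ~ grounded x ->
  exists2 y, reach (-2) u y & potential y < potential x.
Proof.
move=> hu ux ngx.
have [x1N|] := boolP (~~ s x 1 || s x N); first exact: descend_undriven.
rewrite negb_or negbK => /andP[x1 xN].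
have [cx|ncx] := EM (clustered x); last exact: descend_driven.
have [xN1|xN1] := boolP (s x N.-1); first exact: descend_tail.
have [x3|x3] := boolP (s x 3); last exact: descend_first_pair.
have [[r [r0 xr xr1 narrow]]|wide] :=
    EM (exists r, [/\ (0 < r)%N, ~~ s x r, s x r.+1 & ~~ s x r.+3 || s x r.-2]).
  exact: descend_narrow xr xr1 narrow.
case: ngx; split=> //; apply: clustered_packed => // r r0 xr xr1.
have [//|narrow] := boolP (s x r.+3 && ~~ s x r.-2).
by case: wide; exists r; split=> //; move: narrow; rewrite negb_and negbK.
Qed.

Lemma packed_clustered x : packed x -> clustered x.
Proof.
move=> px; split=> [|k k0]; first exact: packed_site1.
by move: (@packed_rise x k px k0); case: (3 < k)%N; bools.
Qed.

Lemma grounded_single u : grounded u ->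
  (forall r, (0 < r)%N -> s u r.+1 -> s u r) -> island u.
Proof.
case=> pu u1 uN down; have /andP[u01 u02] := packed_site1 pu.
have ex : exists k, s u k by exists 1%N.
have bd k : s u k -> (k <= N)%N by move/site_bound/andP=> [].
pose p := ex_maxn ex bd.
have [up max_p] : s u p /\ (forall k, s u k -> (k <= p)%N).
  by rewrite /p; case: ex_maxnP.
have -> : u = step p; last first.
  by apply: island_step; have := max_p _ u02; have := bd _ up; index_lia.
apply: site_inj => k kN; rewrite site_eta kN /=.
have [kp|pk] := leqP k p; last by apply: contra_ltnF pk => /max_p.
move: up; rewrite -(subnK kp); elim: (p - k)%N => [//|n IH].
by rewrite addSn => /down up; apply: IH; apply: up; case/andP: kN; index_lia.
Qed.

Lemma descend_grounded u : h u = 0 -> grounded u -> ~ island u ->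
  exists2 y, reach (-2) u y & potential y < potential u.
Proof.
move=> hu gu iu; have [pu u1 uN] := gu; have cu := packed_clustered pu.
have [[r [r0 ur ur1]]|single] := EM (exists r, [/\ (0 < r)%N, ~~ s u r & s u r.+1]).
  have := @packed_rise u r pu r0; rewrite ur ur1 => /and5P[_ _ urm _ _].
  by apply: descend_wide hu cu _ u1 uN r0 ur ur1 urm; case: pu => /andP[].
case: iu; apply: grounded_single => // r r0 ur1.
by apply/negPn/negP => ur; case: single; exists r.
Qed.

(* Otherwise, following fastest jumps from a configuration at level 0 carries a flow of
   exponent at least -2 into the island, or into the basin of a grounded configuration of
   level 0 and lower potential. *)
Lemma off_island_lt0 u : ~ island u -> h u < 0.
Proof.
elim/(@potential_ind N potential): u => u outer iu; rewrite lt_neqAle h_le0 andbT.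
apply/eqP => hu.
have inner x : reach (-2) u x -> potential x < potential u -> False.
  elim/(@potential_ind N potential): x => x IH ux xu.
  have [ix|ix] := EM (island x).
    have [y [z [c [iy iz yz le2]]]] := reach_leave ux iu ix.
    by have := le_lt_trans le2 (island_exits iy iz yz); rewrite ltxx.
  have [gx|ngx] := EM (grounded x); last first.
    have [y uy yx] := descend hu ux ngx.
    exact: IH yx uy (lt_trans yx xu).
  have xneq : u <> x by move=> E; move: xu; rewrite E ltxx.
  (* The level of [x] is negative, so its basin emits only flow of exponent below -2; and [u], of
     level 0, cannot lie in that basin. *)
  have hx := outer _ xu ix.
  have [bu|bu] := EM (basin x u).
    by have := lt_trans (basin_lt gx bu xneq) hx; rewrite hu ltxx.
  have bx : basin x x by right; exists x; left.
  have [y [z [c [by_ bz yz le2]]]] := reach_leave ux bu bx.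
  have lt2 : h x - 2 < - 2 by lra_ab.
  by have := le_lt_trans (le_trans le2 (basin_exits gx by_ bz yz)) lt2; rewrite ltxx.
have [gu|ngu] := EM (grounded u).
  by have [y] := descend_grounded hu gu iu; apply: inner.
by have [y] := descend hu (reach_refl _ u) ngu; apply: inner.
Qed.

(** * Equality of the levels of the good steps *)

Lemma step_in_basin p : basin (step p) (step p).
Proof. by right; exists (step p); left. Qed.

(** The flow away from the front is cut at each position of the hole. The range stops at [k = 3]
    because a hole at 2 can leave at exponent 1. *)
Lemma vacancy_level p k : (2 < p < N.-1)%N -> (2 < k <= p)%N ->
  h (step p) - 2 <= h (vacancy p k).
Proof.
move=> pN; have [n] := ubnP (p - k)%N; elim: n k => // n IH k kn kp.
have pN1 : (p.+1 < N)%N by index_lia.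
have [->|kE] := eqVneq k p.
  have p1 : (1 < p < N)%N by index_lia.
  have ev : exits_le (vacancy p p) 1.
    by apply: exits_le1; rewrite site_vacancy; index_lia.
  by have := inflow_exits_le (jump_step p1) ev; lra_ab.
have IHk : h (step p) - 2 <= h (vacancy p k.+1) by apply: IH; index_lia.
have := @jump_vacancyL p k.+1.
rewrite (_ : (k.+1 == 2) = false); last index_lia.
rewrite (_ : (1 < k.+1 <= p)%N); last index_lia.
move=> /(_ isT pN1) /= jL; have := inflow_exits_le jL (@exits_vacancy_le0 p k _ pN1).
by rewrite (_ : (2 < k < p)%N); [move=> /(_ isT); lra_ab|index_lia].
Qed.

Lemma exits_vacancy1_le p : (1 < p)%N -> (p.+1 < N)%N -> exits_le (vacancy p 1) (a + 1).
Proof.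
move=> p1 pN; apply: (exits_leI (g := 1)).
- by move=> *; apply: gain_le1.
- by lra_ab.
- by rewrite !site_vacancy; decide_nat; rewrite mul1r.
- rewrite right_creation; first by case: (s _ _) => /=; lra_ab.
  by rewrite site_vacancy; index_lia.
Qed.

(** The basin of the next step admits at most [h (step p.+1) - 2], and the hole brings at least
    [h (step p) - 2]. *)
Lemma step_level_up p : (2 < p)%N -> (p.+2 < N)%N -> h (step p) <= h (step p.+1).
Proof.
move=> p2 pN2; have pN1 : (p.+1 < N)%N by index_lia.
have pN : (2 < p < N.-1)%N by index_lia.
have l3 := vacancy_level (p := p) (k := 3) pN p2.
have j3 : jump (vacancy p 3) (vacancy p 2) 0 by apply: (@jump_vacancyL p 3).
have j2 : jump (vacancy p 2) (vacancy p 1) 1.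
  by apply: (@jump_vacancyL p 2); index_lia.
have e2 : exits_le (vacancy p 2) 1.
  by apply: exits_le1; rewrite site_vacancy; index_lia.
have e1 : exits_le (vacancy p 1) (a + 1) by apply: exits_vacancy1_le; index_lia.
have p0 : (0 < p)%N by index_lia.
have g1 : grounded (step p.+1) by apply: grounded_step; index_lia.
have nb : ~ basin (step p.+1) (vacancy p 1) by apply: vacancy_notin_basin; index_lia.
have := basin_inflow g1 nb (step_in_basin p.+1) (jump_vacancy1 p0 pN1).
have := inflow_exits_le j2 e1; have := inflow_exits_le j3 e2; lra_ab.
Qed.

Lemma adatom_level p k : (2 < p < N.-1)%N -> (p < k < N)%N ->
  h (step p) - 2 <= h (adatom p k).
Proof.
move=> pN; elim: k => // k IH kN.
have [<-|kp] := eqVneq p k.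
  by rewrite -vacancy_adatom; [apply: vacancy_level|]; index_lia.
have jR : jump (adatom p k) (adatom p k.+1) 0.
  have [->|kE] := eqVneq k p.+1; last by apply: jump_adatomR; index_lia.
  by rewrite -vacancy_adatom; [apply: jump_vacancy_adatom|]; index_lia.
have k1 : h (step p) - 2 <= h (adatom p k) by apply: IH; index_lia.
have := inflow_exits_le jR (@exits_adatom_le0 p k.+1 _ _).
rewrite (_ : (2 < p)%N); last index_lia.
rewrite (_ : (p.+1 < k.+1 < N)%N); last index_lia.
by move=> /(_ isT isT); lra_ab.
Qed.

Lemma vacancy_last_notin_basin p q : (2 < p < q)%N -> (q.+1 < N)%N ->
  ~ basin (step p) (vacancy q q).
Proof.
move=> pq qN H.
have v0 : s (vacancy q q) q = false by rewrite site_vacancy; index_lia.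
have v1 : s (vacancy q q) q.+1 by rewrite site_vacancy; index_lia.
have vN : s (vacancy q q) N = false by rewrite site_vacancy; index_lia.
have vp : s (vacancy q q) p by rewrite site_vacancy; index_lia.
case: H v0 v1 vN vp => [->|[z bz zE]].
  by rewrite toggle_eta ?site_adatom; index_lia.
have zp : z = step p.
  by case: bz => // -[]; rewrite site_eta; index_lia.
case: zE => [->|[k [kN neq ->]]]; rewrite zp.
  by rewrite !site_eta; index_lia.
rewrite zp in neq; rewrite (eta_hops kN neq) hop_eta; last index_lia.
by rewrite !site_vacancy; index_lia.
Qed.

Lemma step_level_down p : (2 < p)%N -> (p.+2 < N)%N -> h (step p.+1) <= h (step p).
Proof.
move=> p2 pN; have pN1 : (2 < p.+1 < N.-1)%N by index_lia.
have l := @adatom_level p.+1 N.-1 pN1 _.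
have gp : grounded (step p) by apply: grounded_step; index_lia.
have bw : basin (step p) (adatom p.+1 N).
  by left; rewrite toggle_eta //; index_lia.
have {}l : h (step p.+1) - 2 <= h (adatom p.+1 N.-1) by apply: l; index_lia.
suff : h (adatom p.+1 N.-1) + 0 <= h (step p) - 2 by lra_ab.
(* When only two vacant sites follow the larger step, the particle at [N.-1] has just detached and
   the configuration is [vacancy p.+1 p.+1]. *)
have [pE|pE] := eqVneq p.+3 N.
  have aE : adatom p.+1 N.-1 = vacancy p.+1 p.+1.
    have kE : N.-1 = p.+2 by index_lia.
    by rewrite vacancy_adatom // kE.
  have jv : jump (vacancy p.+1 p.+1) (adatom p.+1 N) 0.
    by have := @jump_vacancy_adatom p.+1; rewrite pE; apply; index_lia.
  rewrite aE; apply: basin_inflow jv => //.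
  by apply: vacancy_last_notin_basin; index_lia.
have jR : jump (adatom p.+1 N.-1) (adatom p.+1 N) 0.
  by have := @jump_adatomR p.+1 N.-1; rewrite N1S; apply; index_lia.
apply: basin_inflow jR => //.
by apply: adatom_notin_basin; index_lia.
Qed.

Lemma step_level p : (2 < p < N.-1)%N -> h (step p) = h (step 3).
Proof.
elim: p => // p IH pN; have [->//|p3] := eqVneq p 2.
rewrite -IH; last index_lia.
by apply/eqP; rewrite eq_le step_level_down ?step_level_up //; index_lia.
Qed.

(** [step 2] feeds [vacancy 2 2] at exponent -1, and the latter is left at exponent at most 1; the
    steps with at most one vacant site lie in the basin of [step N.-2]. *)
Lemma island_lt0 x : island x -> (forall p, (2 < p < N.-1)%N -> x <> step p) -> h x < 0.
Proof.
case=> [[p pN ->]|[p [k [p1 pN kp ->]]]|[p [k [pN kN ->]]]] nx.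
- have [->|p2] := eqVneq p 2.
    have p2N : (1 < 2 < N)%N by index_lia.
    have e2 : exits_le (vacancy 2 2) 1.
      by apply: exits_le1; rewrite site_vacancy; index_lia.
    by have := inflow_exits_le (jump_step p2N) e2; have := h_vacancy22_le; lra_ab.
  have g2 : grounded (step N.-2) by apply: grounded_step; index_lia.
  have N2 : s (step N.-2) N.-2 by rewrite site_eta; index_lia.
  have vE : toggle (step N.-2) N.-1 = step N.-1 by site_by_site.
  apply: lt_le_trans (h_le0 (step N.-2)); apply: basin_lt => //.
    right; exists (step p); last by left.
    right; split=> //; have [->|pE] := eqVneq p N.-1; first by left; rewrite vE.
    right; rewrite vE toggle_eta ?N1S ?adatom_eta; try index_lia.
    have -> // : p = N.
    have [//|pN'] := eqVneq p N; case: (nx p) => //; index_lia.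
  by apply: nx; index_lia.
- have [->|k1] := eqVneq k 1; first by have := h_vacancy1_le p1 pN; lra_ab.
  have [pE|p2] := eqVneq p 2.
    have kE : k = 2 by index_lia.
    by have := h_vacancy22_le; rewrite pE kE; lra_ab.
  have := @h_vacancy_le p k; rewrite pN (_ : (2 < p)%N); last index_lia.
  rewrite (_ : (1 < k <= p)%N); last index_lia.
  by move=> /(_ isT isT isT); have := h_le0 (step p); lra_ab.
have [->|kE] := eqVneq k N; first by have := h_adatomN_le pN; lra_ab.
have := @h_adatom_le p k; rewrite (_ : (2 < p < N.-1)%N); last index_lia.
rewrite (_ : (p < k < N)%N); last index_lia.
by move=> /(_ isT isT); have := h_le0 (step p); lra_ab.
Qed.

Lemma level_lt0 x : (forall p, (2 < p < N.-1)%N -> x <> step p) -> h x < 0.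
Proof.
by move=> nx; have [ix|] := EM (island x); [apply: island_lt0|apply: off_island_lt0].
Qed.

Lemma level_step_eq0 p : (exists x, h x = 0) -> (2 < p < N.-1)%N -> h (step p) = 0.
Proof.
case=> x hx pN; have [[q qN xE]|nx] := EM (exists2 q, (2 < q < N.-1)%N & x = step q).
  by rewrite step_level // -(step_level qN) -xE.
have : h x < 0 by apply: level_lt0 => q qN xE; apply: nx; exists q.
by rewrite hx ltxx.
Qed.

(** * Connectedness of the jump graph *)

Lemma jump_to_vacuum (A : config N -> Prop) x :
  (forall y z c, A y -> jump y z c -> A z) -> A x -> A (step 0).
Proof.
(* The leftmost particle slides to site 1 and is removed there; each move lowers the sum of the
   occupied positions. *)
move=> closed; elim/(@potential_ind N (weight (fun k => k%:Z))): x => x IH Ax.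
have [[k sk]|vac] := EM (exists k, s x k); last first.
  suff <- : x = step 0 by [].
  apply: site_inj => k kN; rewrite site_eta.
  by case sk: (s x k); [case: vac; exists k|index_lia].
have ex : exists k, s x k by exists k.
case: (ex_minnP ex) => {k sk ex} k sk min_k.
have kN := site_bound sk.
have [k1|k1] := eqVneq k 1.
  rewrite {}k1 in sk kN min_k.
  apply: (IH (toggle x 1)); last exact: closed Ax (jump_left x).
  by rewrite weight_toggle // sk; index_lia.
have kN' : (0 < k.-1 < N)%N by index_lia.
have kS : k.-1.+1 = k by index_lia.
have skp : s x k.-1 = false by apply/negP => /min_k; index_lia.
have neq : s x k.-1 != s x k.-1.+1 by rewrite kS sk skp.
apply: (IH (hop x k.-1)); last exact: closed Ax (jump_hop kN' neq).
by rewrite weight_hop // kS sk skp; index_lia.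
Qed.

(** If no jump left [A], then by symmetry of the jump relation none would leave its complement, and
    the vacuum would belong to both. *)
Lemma jump_connected (A : config N -> Prop) : (exists x, A x) -> (exists y, ~ A y) ->
  exists x y c, [/\ A x, ~ A y & jump x y c].
Proof.
move=> [x Ax] [y Ay].
have [//|closed] := EM (exists x y c, [/\ A x, ~ A y & jump x y c]).
have A0 : A (step 0).
  apply: jump_to_vacuum Ax => u v c Au uv.
  by have [//|Av] := EM (A v); case: closed; exists u, v, c.
have : ~ A (step 0); last by [].
apply: (jump_to_vacuum (A := fun z => ~ A z)) Ay => u v c Au uv Av.
by have [d vu] := jump_sym uv; case: closed; exists v, u, d.
Qed.

End Landscape.

(** * Calculus of exponential orders *)

Section Asymptotics.
Variable R : realType.
Implicit Types (f g : R -> R) (c d e : R) (S T : R -> Prop).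

Definition tame f e : Prop := (forall t, 0 < f t) /\ asymp f e.

Lemma asymp_unique f d e : asymp f d -> asymp f e -> d = e.
Proof. by move=> fd fe; apply: (cvg_unique _ fd fe). Qed.

Lemma tame_unique f g d e : tame f d -> tame g e -> f =1 g -> d = e.
Proof. by move=> [_ fd] [_ ge] /funext fg; move: fd; rewrite fg => /asymp_unique; apply. Qed.

Lemma tame_expR f e : (forall t, f t = e * t) -> tame (fun t => expR (f t)) e.
Proof.
move=> fE; split=> [t|]; first exact: expR_gt0.
rewrite /asymp; apply: cvg_near_cst.
near=> t; rewrite expRK fE mulfK //.
by apply: lt0r_neq0; near: t; apply: nbhs_pinfty_gt.
Unshelve. all: by end_near. Qed.

Lemma tameM f g d e : tame f d -> tame g e -> tame (fun t => f t * g t) (d + e).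
Proof.
move=> [f0 fd] [g0 ge]; split=> [t|]; first by rewrite mulr_gt0.
rewrite /asymp (_ : (fun t => _) = (fun t => ln (f t) / t + ln (g t) / t)).
  exact: cvgD.
by apply/funext => t; rewrite lnM ?posrE // mulrDl.
Qed.

Lemma tameV f e : tame f e -> tame (fun t => (f t)^-1) (- e).
Proof.
move=> [f0 fe]; split=> [t|]; first by rewrite invr_gt0.
rewrite /asymp (_ : (fun t => _) = (fun t => - (ln (f t) / t))).
  exact: cvgN.
by apply/funext => t; rewrite lnV ?posrE // mulNr.
Qed.

Definition tends f e : Prop := (f @ +oo --> e)%classic.

Lemma tends_max f g d e : tends f d -> tends g e ->
  tends (fun t => Num.max (f t) (g t)) (Num.max d e).
Proof.
move=> fd ge; rewrite /tends maxr_absE.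
rewrite (_ : (fun t => _) = (fun t => (f t + g t + `|f t - g t|) / 2)); last first.
  by apply/funext => t; rewrite maxr_absE.
by apply: cvgMl; apply: cvgD; [apply: cvgD|apply: cvg_norm; apply: cvgB].
Qed.

Lemma tends_inv : tends (fun t => t^-1) 0.
Proof.
apply/cvgrPdist_le => e e0; near=> t.
have te : e^-1 <= t by near: t; apply: nbhs_pinfty_ge; apply: num_real.
have t0 : 0 < t by apply: lt_le_trans te; rewrite invr_gt0.
by rewrite sub0r normrN gtr0_norm ?invr_gt0 // -[e]invrK lef_pV2 // posrE ?invr_gt0.
Unshelve. all: by end_near. Qed.

(** For positive [t], [ln (f t + g t) / t] exceeds the larger of the two separate quotients by at
    most [ln 2 / t]. *)
Lemma tameD f g d e : tame f d -> tame g e ->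
  tame (fun t => f t + g t) (Num.max d e).
Proof.
move=> [f0 fd] [g0 ge]; split=> [t|]; first by rewrite addr_gt0.
have lo := tends_max fd ge.
have hi : tends (fun t => Num.max (ln (f t) / t) (ln (g t) / t) + ln 2 * t^-1) (Num.max d e).
  rewrite /tends -[X in (_ --> X)%classic]addr0; apply: cvgD => //.
  rewrite -[X in (_ --> X)%classic](mulr0 (ln 2)); apply: cvgMr.
  exact: tends_inv.
apply: (squeeze_cvgr _ lo hi); near=> t.
have t0 : 0 < t by near: t; apply: nbhs_pinfty_gt.
have V0 : 0 <= t^-1 by rewrite invr_ge0 ltW.
have fg0 : 0 < f t + g t by rewrite addr_gt0.
wlog fg : f g d e f0 fd g0 ge {lo hi} fg0 / f t <= g t => [H|].
  have [le_fg|/ltW le_gf] := leP (f t) (g t); first exact: (H f g d e).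
  by rewrite maxC (addrC (f t)); apply: (H g f e d) => //; rewrite addrC.
have lfg : ln (f t) <= ln (g t) by rewrite ler_ln ?posrE.
have -> : Num.max (ln (f t) / t) (ln (g t) / t) = ln (g t) / t.
  by apply/max_idPr; apply: ler_wpM2r.
apply/andP; split.
  by apply: ler_wpM2r => //; rewrite ler_ln ?posrE // lerDr ltW.
rewrite -mulrDl; apply: ler_wpM2r => //.
rewrite -lnM ?posrE // ler_ln ?posrE ?mulr_gt0 //.
by have := f0 t; lra.
Unshelve. all: by end_near. Qed.

(* Nonnegative functions that vanish identically or are positive with an exponent
   equal to the largest element of [S]. *)
Definition expsum f S : Prop :=
  ((forall t, f t = 0) /\ forall e, ~ S e) \/
  exists e, [/\ S e, forall d, S d -> d <= e & tame f e].

Lemma expsum_ext f g S T : expsum f S -> f =1 g -> (forall e, S e <-> T e) -> expsum g T.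
Proof.
move=> fS /funext <- ST; case: fS => [[f0 S0]|[e [Se le_e fe]]].
  by left; split=> // e /ST; apply: S0.
by right; exists e; split=> // [|d /ST]; [apply/ST|apply: le_e].
Qed.

Lemma expsum0 : expsum (fun=> 0) (fun=> False).
Proof. by left; split=> // e. Qed.

Lemma expsum_tame f e : tame f e -> expsum f (fun d => d = e).
Proof. by move=> fe; right; exists e; split=> // d ->. Qed.

Lemma expsumD f g S T : expsum f S -> expsum g T ->
  expsum (fun t => f t + g t) (fun e => S e \/ T e).
Proof.
case=> [[f0 S0]|[d [Sd le_d fd]]]; case=> [[g0 T0]|[e [Te le_e ge]]].
- by left; split=> [t|e [/S0|/T0]] //; rewrite f0 g0 addr0.
- right; exists e; split; [by right|by move=> c [/S0|/le_e]|].
  by rewrite (_ : (fun t => _) = g) //; apply/funext => t; rewrite f0 add0r.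
- right; exists d; split; [by left|by move=> c [/le_d|/T0]|].
  by rewrite (_ : (fun t => _) = f) //; apply/funext => t; rewrite g0 addr0.
right; exists (Num.max d e); split; last exact: tameD.
  by case: (leP d e); [right|left].
by move=> c; rewrite le_max => -[/le_d ->|/le_e ->]; rewrite ?orbT.
Qed.

Lemma expsumM f g S e : tame f e -> expsum g S ->
  expsum (fun t => f t * g t) (fun d => exists2 c, S c & d = e + c).
Proof.
move=> fe [[g0 S0]|[c [Sc le_c gc]]].
  by left; split=> [t|d [c /S0]] //; rewrite g0 mulr0.
right; exists (e + c); split; [by exists c| |exact: tameM].
by move=> d [c' /le_c ? ->]; rewrite lerD2l.
Qed.

Lemma expsum_sum (I : finType) (P : pred I) (F : I -> R -> R) (S : I -> R -> Prop) :
  (forall i, P i -> expsum (F i) (S i)) ->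
  expsum (fun t => \sum_(i | P i) F i t) (fun e => exists2 i, P i & S i e).
Proof.
move=> FS; have mem_r i : i \in index_enum I by exact: mem_index_enum.
suff: forall r : seq I, expsum (fun t => \sum_(i <- r | P i) F i t)
    (fun e => exists2 i, (i \in r) && P i & S i e).
  move=> /(_ (index_enum I)) /expsum_ext; apply => // e.
  by split=> -[i]; [case/andP|] => *; exists i; rewrite ?mem_r.
elim=> [|i r IH].
  by apply: expsum_ext expsum0 _ _ => [t|e]; [rewrite big_nil|split=> // -[]].
have [Pi|nPi] := boolP (P i); last first.
  apply: expsum_ext IH _ _ => [t|e]; first by rewrite big_cons (negbTE nPi).
  split=> -[j /andP[jr Pj] Sj]; exists j; rewrite // ?inE ?jr ?orbT //.
  by move: jr; rewrite inE => /predU1P[E|->] //; rewrite E (negbTE nPi) in Pj.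
apply: expsum_ext (expsumD (FS i Pi) IH) _ _ => [t|e]; first by rewrite big_cons Pi.
split=> [[Sie|[j /andP[jr Pj] Sj]]|[j /andP[]]].
- by exists i; rewrite // inE eqxx.
- by exists j; rewrite // inE jr orbT.
- by rewrite inE => /predU1P[->|jr] Pj Sj; [left|right; exists j; rewrite ?jr].
Qed.

(** A function has a single exponent, so two descriptions of it share their maximum; this turns an
    equality of flows into an inequality of exponents. *)
Lemma expsum_max f S T : expsum f S -> expsum f T ->
  forall e, S e -> exists2 d, T d & e <= d.
Proof.
case=> [[_ S0]|[d [Sd le_d fd]]] fT e Se; first by case: (S0 e).
case: fT => [[f0 _]|[d' [Td' _ fd']]].
  by case: fd => /(_ 0); rewrite f0 ltxx.
by exists d' => //; rewrite -(tame_unique fd fd' (frefl _)); apply: le_d.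
Qed.

Lemma expsum_pos f S e : expsum f S -> S e -> exists d, tame f d.
Proof. by case=> [[_ S0] /S0|[d [_ _ fd]]] // _; exists d. Qed.
End Asymptotics.

(** * Stationary weights by state elimination *)

Section Censoring.
Variables (R : realType) (T : finType).
Implicit Types (P : pred T) (r : R -> T -> T -> R) (rho : R -> T -> R) (x y z : T).

Definition sparse (f : R -> R) : Prop := (forall t, f t = 0) \/ exists e, tame f e.

Lemma expsum_sparse f S : expsum f S -> sparse f.
Proof. by case=> [[f0 _]|[e [_ _ fe]]]; [left|right; exists e]. Qed.

Lemma sparse_expsum f : sparse f -> exists S, expsum f S.
Proof.
case=> [f0|[e fe]]; first by exists (fun=> False); left; split=> // e.
by exists (fun d => d = e); apply: expsum_tame.
Qed.

Lemma sparseD f g : sparse f -> sparse g -> sparse (fun t => f t + g t).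
Proof.
move=> /sparse_expsum[S fS] /sparse_expsum[S' gS].
exact: expsum_sparse (expsumD fS gS).
Qed.

Lemma sparseM f g : sparse f -> sparse g -> sparse (fun t => f t * g t).
Proof.
case=> [f0 _|[e fe] /sparse_expsum[S gS]]; first by left=> t; rewrite f0 mul0r.
exact: expsum_sparse (expsumM fe gS).
Qed.

Lemma tame_sparse f e : tame f e -> sparse f.
Proof. by right; exists e. Qed.

Lemma sparse_ge0 f t : sparse f -> 0 <= f t.
Proof. by case=> [->//|[e [/(_ t)/ltW]]]. Qed.

Lemma tame_sum P (F : T -> R -> R) z : (forall x, P x -> sparse (F x)) ->
  P z -> 0 < F z 0 -> exists e, tame (fun t => \sum_(x | P x) F x t) e.
Proof.
move=> sF Pz Fz.
have /choice[S FS] : forall x, exists S, P x -> expsum (F x) S.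
  by move=> x; have [/sF/sparse_expsum[S]|] := boolP (P x); [exists S|exists (fun=> False)].
case: (expsum_sum FS) => [[F0 _]|[e [_ _ fe]]]; last by exists e.
move: (F0 0) => /eqP; rewrite psumr_eq0 => [/allP /(_ z)|x /sF sx].
  by rewrite mem_index_enum Pz /= => /(_ isT)/eqP E; rewrite E ltxx in Fz.
exact: sparse_ge0.
Qed.

(** Sparse rates vanish identically or are positive everywhere, so testing positivity at parameter 0
    is enough. *)
Definition irreducible P r : Prop := forall A : pred T,
  (exists2 x, P x & A x) -> (exists2 y, P y & ~~ A y) ->
  exists x y, [/\ P x, A x, P y, ~~ A y & 0 < r 0 x y].

Definition balanced P r rho : Prop := forall t y, P y ->
  \sum_(x | P x) rho t x * r t x y = rho t y * \sum_(x | P x) r t y x.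

(* State elimination: removing a state [z] and rerouting its flow yields a balanced
   process on the remaining states, and keeps the rates within tame functions. *)
Lemma balanced_ratio P r rho : (forall x y, sparse (fun t => r t x y)) ->
  irreducible P r -> balanced P r rho ->
  forall x y, P x -> P y ->
  exists f, (exists e, tame f e) /\ forall t, rho t x = f t * rho t y.
Proof.
have [n] := ubnP #|P|; elim: n P r => // n IH P r Pn sr irr bal x y Px Py.
have one_ratio u : exists f, (exists e, tame f e) /\ forall t, rho t u = f t * rho t u.
  exists (fun=> 1); split=> [|t]; last by rewrite mul1r.
  exists 0; rewrite (_ : (fun=> 1) = (fun t : R => expR 0)); last first.
    by apply/funext => t; rewrite expR0.
  by apply: tame_expR => t; rewrite mul0r.
have [->|xy] := eqVneq x y; first exact: one_ratio.
suff ratio z : P z -> z != y ->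
    (forall u v, P u -> u != z -> P v -> v != z ->
      exists f, (exists e, tame f e) /\ forall t, rho t u = f t * rho t v) /\
    exists f, (exists e, tame f e) /\ forall t, rho t z = f t * rho t y.
  by have [] := ratio x Px xy.
move=> Pz zy; pose P' := [pred u | P u && (u != z)].
pose out t := \sum_(w | P' w) r t z w.
have [e oute] : exists e, tame out e.
  have [||u [v [_ /eqP -> Pv vz uv]]] := irr (pred1 z); first by exists z; rewrite /= ?eqxx.
    by exists y; rewrite //= eq_sym.
  by apply: (tame_sum (z := v)) => //=; rewrite Pv.
have out0 t : out t != 0 by case: oute => /(_ t) o _; rewrite gt_eqF.
(* Excursions to [z] also create self-rates [r' t u u]; these enter both sides of [balanced]
   alike. *)
pose r' t u v := r t u v + r t u z * r t z v / out t.
have sumP (F : T -> R) : \sum_(u | P u) F u = F z + \sum_(u | P' u) F u.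
  by rewrite (bigD1 z).
have to_z t : \sum_(u | P' u) rho t u * r t u z = rho t z * out t.
  have := bal t z Pz; rewrite !sumP mulrDr => /addrI ->.
  by [].
have sr' u v : sparse (fun t => r' t u v).
  apply: sparseD => //; apply: sparseM; first exact: sparseM.
  exact: tame_sparse (tameV oute).
have irr' : irreducible P' r'.
  move=> A [u /andP[Pu uz] Au] [v /andP[Pv vz] Av].
  have pos (f : R -> R) t : sparse f -> 0 <= f t by exact: sparse_ge0.
  (* If the jump leaving [A] ends at [z], a jump leaving [A] together with [z] is sought; should
     that one start at [z], the two compose to an excursion. *)
  have [||a [b' [Pa /andP[Aa az] Pb Ab ab]]] := irr [pred w | A w && (w != z)].
  - by exists u; rewrite //= Au.
  - by exists v; rewrite //= (negbTE Av).
  have [bz|bz] := eqVneq b' z; last first.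
    exists a, b'; split=> //=; rewrite ?Pa ?Pb //; first by move: Ab; rewrite /= bz andbT.
    apply: ltr_wpDr ab; rewrite divr_ge0 ?mulr_ge0 //; try exact: (sparse_ge0 0 (sr _ _)).
    by case: oute => /(_ 0)/ltW.
  rewrite {}bz in ab; rewrite {b' Pb Ab}.
  have [||c [d [Pc Ac Pd /norP[Ad dz] cd]]] := irr [pred w | A w || (w == z)].
  - by exists u; rewrite //= Au.
  - by exists v; rewrite //= (negbTE Av).
  have [cz|cz] := eqVneq c z; last first.
    exists c, d; split=> //=; rewrite ?Pc ?Pd //; first by move: Ac; rewrite /= (negbTE cz) orbF.
    apply: ltr_wpDr cd; rewrite divr_ge0 ?mulr_ge0 //; try exact: (sparse_ge0 0 (sr _ _)).
    by case: oute => /(_ 0)/ltW.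
  rewrite {}cz in cd; exists a, d; split=> //=; rewrite ?Pa ?Pd //.
  apply: ltr_wpDl; first exact: (sparse_ge0 0 (sr _ _)).
  by rewrite divr_gt0 ?mulr_gt0 //; case: oute => /(_ 0).
have bal' : balanced P' r' rho.
  move=> t v /andP[Pv vz].
  under eq_bigr => u _ do rewrite mulrDr !mulrA.
  rewrite big_split /= -!mulr_suml to_z.
  have := bal t v Pv; rewrite !sumP => balv.
  rewrite [X in _ = _ * X]big_split /=.
  under [X in _ = _ * (_ + X)]eq_bigr => u _ do rewrite -mulrA.
  rewrite -mulr_sumr -mulr_suml -/(out t) divff // mulr1 [in RHS]addrC -balv.
  rewrite [in RHS]addrC; congr (_ + _).
  by rewrite (mulrAC _ (out t)) mulfK.
have P'n : (#|P'| < n)%N.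
  by move: Pn; rewrite (cardD1x Pz) add1n ltnS.
have ratio u v : P u -> u != z -> P v -> v != z ->
    exists f, (exists e, tame f e) /\ forall t, rho t u = f t * rho t v.
  by move=> Pu uz Pv vz; apply: (IH P' r' P'n sr' irr' bal'); rewrite /= ?Pu ?Pv.
split=> //.
have yz : y != z by rewrite eq_sym.
(* The weight of [z] is recovered from balance at [z]: its inflow divided by [out]. *)
have /choice[f fP] : forall u, exists f, P' u ->
    (exists e, tame f e) /\ forall t, rho t u = f t * rho t y.
  move=> u; have [/andP[Pu uz]|] := boolP (P' u); last by exists (fun=> 0).
  by have [f ?] := ratio u y Pu uz Py yz; exists f.
have [||u [v [/= Pu Au _ /negPn/eqP -> uv]]] := irr [pred w | w != z].
- by exists y.
- by exists z; rewrite //= eqxx.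
have [d fd] : exists d, tame (fun t => \sum_(u | P' u) f u t * r t u z) d.
  apply: (tame_sum (z := u)); rewrite /= ?Pu //.
    by move=> w /fP[[d fd] _]; apply: sparseM => //; apply: tame_sparse fd.
  have [|[d [+ _]] _] := fP u; first by rewrite /= Pu.
  by move=> /(_ 0) ?; rewrite mulr_gt0.
exists (fun t => (\sum_(u | P' u) f u t * r t u z) * (out t)^-1); split.
  by eexists; apply: tameM fd (tameV oute).
move=> t; apply: (mulIf (out0 t)); rewrite -to_z mulrAC mulfVK // mulr_suml.
by apply: eq_bigr => w /fP[_ ->]; rewrite mulrAC.
Qed.
End Censoring.

(** * Exponents of the stationary distribution of the Kawasaki process *)

Section Process.
Variables (R : realType) (N : nat) (kappa muL muR : R).
Hypotheses (N_ge5 : (5 <= N)%N) (kappa_gt0 : (0 : R) < kappa).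
Implicit Types (x y z : config N).
Let a := muL / kappa.
Let b := - muR / kappa.

Lemma energy_bonds x : energy kappa x = - kappa * (bonds x)%:~R.
Proof.
rewrite /energy; congr (_ * _); rewrite /bonds.
rewrite big_nat_recl // site0 /= add0r.
rewrite [in RHS](big_cat_nat (n := N.-1)) ?leq_pred //=.
rewrite [X in (_ + X)%:~R]big_nat_cond [X in (_ + X)%:~R]big1 ?addr0; last first.
  by move=> k /andP[kN _]; rewrite (@site_out _ x k.+2) ?andbF //; lia.
by rewrite rmorph_sum /=; apply: eq_bigr => k _; rewrite -pmulrn.
Qed.

Lemma swap_hop x (i j : 'I_N) : i.+1 = j -> swap x i j = hop x i.+1.
Proof.
move=> ij; apply/ffunP => k; have xj : site x i.+2 = x j by rewrite ij siteS.
rewrite !ffunE xj !siteS !eqSS -(inj_eq val_inj) /=.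
by rewrite -(inj_eq val_inj k j) /= -ij.
Qed.

Lemma flip_toggle x (i : 'I_N) : flip x i = toggle x i.+1.
Proof.
apply/ffunP => k; rewrite !ffunE !siteS eqSS -(inj_eq val_inj) /=.
by case: eqP => [/val_inj ->|].
Qed.

Lemma expsum_rate x y : expsum (fun t => rate t kappa muL muR x y)
  (fun e => exists2 c, jump a b x y c & e = kappa / 2 * c).
Proof.
have k0 : kappa != 0 by rewrite gt_eqF.
have eb : kappa * a = muL by rewrite /a mulrC divfK.
have eb' : kappa * b = - muR by rewrite /b mulrC divfK.
pose S1 (i j : 'I_N) e := e = kappa / 2 * (gain (site x) i.+1)%:~R.
have E1 (i j : 'I_N) : [&& (i.+1 == j)%N, x i != x j & swap x i j == y] ->
  expsum (fun t => expR (- (t / 2) * (energy kappa (swap x i j) - energy kappa x))) (S1 i j).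
  move=> /and3P[/eqP ij neq _]; apply: expsum_tame; apply: tame_expR => t.
  have iN : (0 < i.+1 < N)%N by have := ltn_ord j; lia.
  have sneq : site x i.+1 != site x i.+2 by rewrite siteS ij siteS.
  rewrite swap_hop // !energy_bonds bonds_hop // /gain.
  move: sneq; case: (site x i.+1); case: (site x i.+2) => //= _;
  case: (site x i.+3); case: (site x i) => /=; rewrite ?intrD ?rmorphM ?rmorphB /=; ring.
have occE (i : 'I_N) : occ R x i = (site x i.+1)%:R by rewrite siteS.
pose cL : R := (if site x 1 then -1 else 1) * (a + (site x 2)%:R).
have E2 (i : 'I_N) : ((i : nat) == 0)%N && (flip x i == y) ->
  expsum (fun t => expR ((t * muL / 2) * (1 - 2 * occ R x i)) *
    expR (- (t / 2) * (energy kappa (flip x i) - energy kappa x))) (fun e => e = kappa / 2 * cL).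
  move=> /andP[/eqP i0 _]; apply: expsum_tame.
  under eq_fun do rewrite -expRD.
  apply: tame_expR => t; rewrite flip_toggle occE i0 !energy_bonds.
  rewrite bonds_toggle /=; last lia.
  rewrite ?site0 /cL -{1}eb.
  by case: (site x 1); case: (site x 2) => /=; rewrite ?intrD ?rmorphM ?rmorphB /=; field.
pose cR : R := (if site x N then 1 else -1) * (b - (site x N.-1)%:R).
have E3 (i : 'I_N) : ((i : nat) == N.-1)%N && (flip x i == y) ->
  expsum (fun t => expR ((t * muR / 2) * (1 - 2 * occ R x i)) *
    expR (- (t / 2) * (energy kappa (flip x i) - energy kappa x))) (fun e => e = kappa / 2 * cR).
  move=> /andP[/eqP iN _]; apply: expsum_tame.
  have N1S : N.-1.+1 = N by lia.
  under eq_fun do rewrite -expRD.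
  apply: tame_expR => t; rewrite flip_toggle occE iN N1S !energy_bonds.
  rewrite bonds_toggle /=; last lia.
  rewrite (@site_out _ x N.+1) // /cR.
  have -> : muR = - (kappa * b) by rewrite eb' opprK.
  by case: (site x N); case: (site x N.-1) => /=; rewrite ?intrD ?rmorphM ?rmorphB /=; field.
apply: expsum_ext (expsumD (expsumD
  (expsum_sum (fun i _ => expsum_sum (E1 i))) (expsum_sum E2)) (expsum_sum E3)) (frefl _) _.
have N0 : (0 < N)%N by lia.
have N1 : (N.-1 < N)%N by lia.
move=> e; split=> [[[[i _ [j /and3P[/eqP ij neq /eqP E] ->]]|[i /andP[/eqP i0 /eqP E] ->]]|
  [i /andP[/eqP iN /eqP E] ->]]|[c []]].
- eexists; last by []; rewrite -E swap_hop //; apply: jump_hop.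
    by have := ltn_ord j; lia.
  by rewrite siteS ij siteS.
- by exists cL => //; rewrite -E flip_toggle i0; apply: jump_left.
- exists cR => //; rewrite -E flip_toggle iN (_ : N.-1.+1 = N); last lia.
  exact: jump_right.
- move=> k kN neq ->; left; left.
  have k1 : (k.-1 < N)%N by lia.
  have k2 : (k < N)%N by lia.
  have kS : k.-1.+1 = k by lia.
  exists (Ordinal k1) => //; exists (Ordinal k2); rewrite /S1 /= kS //.
  rewrite eqxx /= swap_hop //= kS eqxx andbT.
  by have := neq; rewrite -{1}kS (siteS x (Ordinal k1)) (siteS x (Ordinal k2)).
- move=> ->; left; right; exists (Ordinal N0) => //=.
  by rewrite flip_toggle /= eqxx.
- move=> ->; right; exists (Ordinal N1) => //=.
  by rewrite flip_toggle /= eqxx (_ : N.-1.+1 = N) ?eqxx //; lia.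
Qed.

Variable rho : R -> config N -> R.
Hypothesis rho_stat : forall t, stationary t kappa muL muR (rho t).
Local Notation rate_ t x y := (rate t kappa muL muR x y).

Lemma rate_irreducible : irreducible predT (fun t x y => rate_ t x y).
Proof.
move=> A [x _ Ax] [y _ Ay].
have [||u [v [c [Au Av uv]]]] := @jump_connected R N a b N_ge5 (fun z => A z).
- by exists x.
- by exists y; apply/negP.
have [|d [uvd _]] := @expsum_pos _ _ _ (kappa / 2 * c) (expsum_rate u v); first by exists c.
by exists u, v; split=> //; apply/negP.
Qed.

(** Elimination gives tame ratios to the vacuum, and normalisation then determines the weight of the
    vacuum. *)
Lemma rho_tame : exists g : config N -> R, forall x, tame (fun t => rho t x) (g x).
Proof.
pose o : config N := Defs.eta N 0.
have bal : balanced predT (fun t x y => rate_ t x y) rho.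
  by move=> t y _; have [_ [_]] := rho_stat t; apply.
have ratio := balanced_ratio (fun x y => expsum_sparse (expsum_rate x y)) rate_irreducible bal.
have /choice[f fP] : forall x, exists f, (exists e, tame f e) /\
    forall t, rho t x = f t * rho t o by move=> x; apply: ratio.
have [d fd] : exists d, tame (fun t => \sum_(x | predT x) f x t) d.
  apply: (tame_sum (z := o)) => // [x _|]; first by have [[e fe] _] := fP x; apply: tame_sparse fe.
  by have [[e [fe _]] _] := fP o; apply: fe.
have oE t : rho t o = (\sum_(x | predT x) f x t)^-1.
  have [_ [sum1 _]] := rho_stat t.
  have S0 : \sum_(x | predT x) f x t != 0 by case: fd => /(_ t) fd0 _; rewrite gt_eqF.
  apply: (mulfI S0); rewrite divff // -sum1 mulr_suml; apply: eq_bigr => x _.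
  by have [_ ->] := fP x.
have /choice[g gP] : forall x, exists e, tame (fun t => rho t x) e.
  move=> x; have [[e fe] fE] := fP x; exists (e - d).
  rewrite (_ : (fun t => _) = (fun t => f x t * (\sum_(x | predT x) f x t)^-1)).
    exact: tameM fe (tameV fd).
  by apply/funext => t; rewrite fE oE.
by exists g.
Qed.

Variable g : config N -> R.
Hypothesis rho_g : forall x, tame (fun t => rho t x) (g x).

(** The weights sum to 1, whose exponent is 0, and the exponent of a sum is the largest one. *)
Lemma exponent_max : (forall x, g x <= 0) /\ exists x, g x = 0.
Proof.
have : expsum (fun=> 1 : R) (fun e => exists2 x, predT x & e = g x).
  apply: expsum_ext (expsum_sum (fun x _ => expsum_tame (rho_g x))) _ _ => [t|e]; last exact: iff_refl.

  by have [_ [sum1 _]] := rho_stat t; rewrite -[RHS]sum1.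
case=> [[/(_ 0)/eqP]|[e [[x _ ex] le_e oneE]]]; first by rewrite oner_eq0.
have e0 : e = 0.
  have zeroE : tame (fun t : R => expR 0) 0 by apply: tame_expR => t; rewrite mul0r.
  by apply: (tame_unique oneE zeroE) => t; rewrite expR0.
by split=> [y|]; [rewrite -e0; apply: le_e; exists y|exists x; rewrite -ex].
Qed.

(** Stationarity is summed over [A], and the flow inside [A] cancels. *)
Lemma stationary_cut (A : pred (config N)) t :
  \sum_(x | ~~ A x) \sum_(y | A y) rho t x * rate_ t x y =
  \sum_(x | A x) \sum_(y | ~~ A y) rho t x * rate_ t x y.
Proof.
have [_ [_ bal]] := rho_stat t.
have : \sum_(y | A y) \sum_x rho t x * rate_ t x y =
       \sum_(y | A y) \sum_x rho t y * rate_ t y x.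
  by apply: eq_bigr => y _; rewrite bal mulr_sumr.
under eq_bigr => y _ do rewrite (bigID A) /=.
under [X in _ = X]eq_bigr => y _ do rewrite (bigID A) /=.
rewrite !big_split /= [X in X + _]exchange_big /= => /addrI <-.
by rewrite exchange_big.
Qed.

Lemma exponent_cut (A : config N -> Prop) x y c : jump a b x y c -> ~ A x -> A y ->
  exists z w d, [/\ A z, ~ A w, jump a b z w d &
    g x + kappa / 2 * c <= g z + kappa / 2 * d].
Proof.
move=> xy Ax Ay; pose B z := `[< A z >].
have flow z w : expsum (fun t => rho t z * rate_ t z w)
    (fun e => exists2 e', (exists2 c, jump a b z w c & e' = kappa / 2 * c) & e = g z + e').
  exact: expsumM (rho_g z) (expsum_rate z w).
have inS := expsum_sum (P := fun z => ~~ B z) (fun z _ => expsum_sum (P := B) (fun w _ => flow z w)).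
have outS := expsum_sum (P := B) (fun z _ => expsum_sum (P := fun w => ~~ B w) (fun w _ => flow z w)).
have inS' := expsum_ext inS (fun t => stationary_cut B t) (fun e => iff_refl _).
have [|e [z Bz [w Bw [e' [d zw ->] ->]]] le_e] := expsum_max inS' outS (e := g x + kappa / 2 * c).
  exists x; first by apply/negP => /asboolP.
  by exists y; [apply/asboolP|exists (kappa / 2 * c) => //; exists c].
exists z, w, d; split=> //; first exact/asboolP.
by move/negP: Bw => Bw /asboolP.
Qed.
End Process.

(** * From levels back to asymptotics *)

Unset Implicit Arguments.

Theorem theorem1 (R : realType) (N : nat) (kappa muL muR : R)
  (rho : R -> config N -> R) :
  (5 <= N)%N -> 0 < kappa -> kappa < muL -> muR < 0 -> kappa < `|muR| ->
  (forall beta : R, stationary beta kappa muL muR (rho beta)) ->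
  forall x : config N,
    (asymp (fun beta => rho beta x) 0 <-> is_eta_good x) /\
    (~ is_eta_good x ->
       exists alpha : R, 0 < alpha /\ asymp (fun beta => rho beta x) (- alpha)).
Proof.
move=> N5 k0 kL mR kR stat x.
have a1 : 1 < muL / kappa by rewrite ltr_pdivlMr // mul1r.
have b1 : 1 < - muR / kappa.
  by rewrite ltr_pdivlMr // mul1r; move: kR; rewrite ltr0_norm.
have [g gP] := rho_tame N5 k0 stat.
have [g_le0 [x0 gx0]] := exponent_max stat gP.
(* Rescaling to the unit [kappa / 2] in which jump exponents are measured. *)
pose h y := 2 / kappa * g y.
have k2 : 0 < 2 / kappa by rewrite divr_gt0.
have cut (A : config N -> Prop) y z c : jump (muL / kappa) (- muR / kappa) y z c ->
    ~ A y -> A z -> exists u v d, [/\ A u, ~ A v,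
      jump (muL / kappa) (- muR / kappa) u v d & h y + c <= h u + d].
  move=> yz Ay Az; have [u [v [d [Au Av uv le_d]]]] := exponent_cut N5 k0 stat gP yz Ay Az.
  exists u, v, d; split=> //.
  have scale w e : h w + e = 2 / kappa * (g w + kappa / 2 * e).
    by rewrite /h; field; rewrite gt_eqF.
  by rewrite !scale ler_pM2l.
have h_le0 y : h y <= 0 by rewrite /h pmulr_rle0.
have goodE : is_eta_good x <-> exists2 p, (2 < p < N.-1)%N & x = Defs.eta N p.
  split=> [[p [q [p3 q2 pq ->]]]|[p pN ->]]; first by exists p => //; lia.
  by exists p, (N - p)%N; split=> //; lia.
have bad : ~ is_eta_good x -> g x < 0.
  move=> nx; have : h x < 0.
    apply: (level_lt0 N5 a1 b1 cut h_le0) => p pN xE.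
    by apply: nx; apply/goodE; exists p.
  by rewrite /h pmulr_rlt0.
have [_ gx] := gP x; split=> [|/bad gx_lt0]; last first.
  by exists (- g x); rewrite oppr_gt0 opprK.
split=> [/(asymp_unique gx) gx_eq0|/goodE[p pN xE]].
  by have [//|/bad] := EM (is_eta_good x); rewrite gx_eq0 ltxx.
have : h x = 0.
  rewrite xE; apply: (level_step_eq0 N5 a1 b1 cut h_le0) => //.
  by exists x0; rewrite /h gx0 mulr0.
by move/eqP; rewrite /h mulf_eq0 gt_eqF //= => /eqP <-.
Qed.
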